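(* Let $\alpha\in(0,2)$ and $d\ge1$. There exists $C_{d,\alpha}>0$ such that for all $\lambda>0$ and $x\in\mathbb{R}^d\setminus\{0\}$ $$R_\lambda(x)\le C_{d,\alpha}\begin{cases}|x|^{\alpha-d}, & \alpha<d,\\ \log\big(1+\frac{1}{\lambda|x|}\big)+1, & \alpha=d=1,\\ |x|^{\alpha-1}\wedge1+\lambda^{\frac{1-\alpha}{\alpha}}, & \alpha>d=1.\end{cases}$$ Furthermore, if $\alpha<d$, then the statement holds also for $\lambda=0$.
   Context: $p_t(x-y)$ is the integral kernel of $e^{-t(-\Delta)^{\alpha/2}}$ on $L^2(\mathbb{R}^d)$, where $(-\Delta)^{\alpha/2}$ is the fractional Laplacian (Fourier multiplier $|y|^\alpha$), and $R_\lambda(x)=\int_0^\infty e^{-\lambda t}p_t(x)\,dt$ is the resolvent kernel of $(\lambda+(-\Delta)^{\alpha/2})^{-1}$. $a\wedge b=\min\{a,b\}$. *)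

(* Defs.v *)
From HB Require Import structures.
From mathcomp Require Import all_boot all_order all_algebra.
From mathcomp Require Import all_classical all_reals all_analysis measurable_realfun.
From mathcomp Require Import complex.

Set Implicit Arguments.
Unset Strict Implicit.
Unset Printing Implicit Defensive.
Import Order.TTheory GRing.Theory Num.Theory.
Import numFieldNormedType.Exports.

Local Open Scope classical_set_scope.
Local Open Scope ring_scope.
Local Open Scope complex_scope.

(* Points of R^d; the coordinates carry the Borel sigma-algebra of R. *)
Notation "'Rd[' R ]_ d" := (d.-tuple (measurableTypeR R))
  (at level 8, R at level 200, d at level 2, format "'Rd[' R ]_ d").

Section lebesgue_Rd.
Context {R : realType}.

Definition tcons n (x : measurableTypeR R * Rd[R]_n) : Rd[R]_n.+1 :=
  [tuple of x.1 :: x.2].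

Lemma measurable_tcons n : measurable_fun setT (@tcons n).
Proof. exact: measurable_cons. Qed.

Section step.
Variables (n : nat) (mu : {sigma_finite_measure set Rd[R]_n -> \bar R}).

Definition lebesgue_step : set Rd[R]_n.+1 -> \bar R :=
  pushforward (@lebesgue_measure R \x mu)%E (@tcons n).

Let prod_cons : {measure set Rd[R]_n.+1 -> \bar R} :=
  measure_function_pushforward__canonical__measure_function_Measure
    (@lebesgue_measure R \x mu)%E (@measurable_tcons n).

Let step0 : lebesgue_step set0 = 0%E.
Proof. exact: (measure0 prod_cons). Qed.

Let step_ge0 A : (0 <= lebesgue_step A)%E.
Proof. exact: (measure_ge0 prod_cons). Qed.

Let step_sigma_additive : semi_sigma_additive lebesgue_step.
Proof. exact: (@measure_semi_sigma_additive _ _ _ prod_cons). Qed.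

HB.instance Definition _ := isMeasure.Build _ _ _ lebesgue_step
  step0 step_ge0 step_sigma_additive.

Let step_sigma_finite : sigma_finite setT lebesgue_step.
Proof.
pose uncons (y : Rd[R]_n.+1) : measurableTypeR R * Rd[R]_n :=
  (thead y, [tuple of behead y]).
have unconsK (x : measurableTypeR R * Rd[R]_n) : uncons (tcons x) = x.
  by case: x => a b; congr pair; exact/val_inj.
have /sigma_finiteP[F [TF ndF Foo]] := sigma_finiteT (@lebesgue_measure R).
have /sigma_finiteP[G [TG ndG Goo]] := sigma_finiteT mu.
exists (fun k => uncons @^-1` (F k `*` G k)).
  rewrite -preimage_bigcup; apply/esym/seteqP; split => // y _ /=.
  have [k _ Fk] : (\bigcup_k F k) (uncons y).1 by rewrite -TF.
  have [l _ Gl] : (\bigcup_k G k) (uncons y).2 by rewrite -TG.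
  exists (maxn k l) => //; split.
    by move: Fk; exact/subsetPset/ndF/leq_maxl.
  by move: Gl; exact/subsetPset/ndG/leq_maxr.
move=> k; have [mF Fk] := Foo k; have [mG Gk] := Goo k; split; last first.
  rewrite /lebesgue_step /pushforward -comp_preimage.
  rewrite (_ : uncons \o _ = id); last exact/funext.
  by rewrite preimage_id product_measure1E// lte_mul_pinfty// ge0_fin_numE.
rewrite -[X in measurable X]setTI.
apply: measurable_fun_pair => //; last first.
- exact: measurableX.
- exact: measurable_behead.
exact: (@measurable_tnth _ _ _ ord0).
Qed.

HB.instance Definition _ := Measure_isSigmaFinite.Build _ _ _ lebesgue_step
  step_sigma_finite.

End step.

Fixpoint lebesgue_Rd (d : nat) : {sigma_finite_measure set Rd[R]_d -> \bar R} :=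
  match d with
  | 0 => \d_([tuple] : Rd[R]_0)
  | n.+1 => lebesgue_step (lebesgue_Rd n)
  end.

End lebesgue_Rd.

Section heat_semigroup.
Context {R : realType}.
Implicit Types (d : nat) (alpha lambda t : R).

Definition Rd0 d : Rd[R]_d := [tuple 0 | i < d].

Definition subRd d (x y : Rd[R]_d) : Rd[R]_d :=
  [tuple (tnth x i - tnth y i : R) | i < d].

Definition dotRd d (x y : Rd[R]_d) : R := \sum_(i < d) tnth x i * tnth y i.

Definition normRd d (x : Rd[R]_d) : R := Num.sqrt (dotRd x x).

(* The underlying real integral is 0 when the integral diverges; all functions
   integrated below are absolutely integrable. *)
Definition cintegral d (f : Rd[R]_d -> R[i]) : R[i] :=
  (\int[lebesgue_Rd d]_y complex.Re (f y)) +i*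
  (\int[lebesgue_Rd d]_y complex.Im (f y)).

Definition cintegrable d (f : Rd[R]_d -> R[i]) : Prop :=
  (lebesgue_Rd d).-integrable setT (fun y => (complex.Re (f y))%:E) /\
  (lebesgue_Rd d).-integrable setT (fun y => (complex.Im (f y))%:E).

Definition cexpi (theta : R) : R[i] := cos theta +i* sin theta.

Definition fourier d (f : Rd[R]_d -> R[i]) (xi : Rd[R]_d) : R[i] :=
  cintegral (fun y => cexpi (- dotRd y xi) * f y).

Definition inv_fourier d (g : Rd[R]_d -> R[i]) (x : Rd[R]_d) : R[i] :=
  (((2 * pi) ^+ d)^-1)%:C * cintegral (fun xi => cexpi (dotRd x xi) * g xi).

Definition semigroup_symbol d alpha t (xi : Rd[R]_d) : R[i] :=
  (expR (- t * normRd xi `^ alpha))%:C.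

(* e^{-t (-Delta)^(alpha/2)} f, for f in L^1; L^1 \cap L^2 is dense in L^2. *)
Definition stable_semigroup d alpha t (f : Rd[R]_d -> R[i]) : Rd[R]_d -> R[i] :=
  inv_fourier (fun xi => semigroup_symbol alpha t xi * fourier f xi).

(* The symbol is even, so that the inverse transform is real; see
   heat_kernelE, and stable_semigroup_kernel for the kernel property. *)
Definition heat_kernel d alpha t (x : Rd[R]_d) : R :=
  complex.Re (inv_fourier (semigroup_symbol alpha t) x).

Definition resolvent_kernel d alpha lambda (x : Rd[R]_d) : \bar R :=
  (\int[lebesgue_measure]_(t in `]0%R, +oo[)
     (expR (- lambda * t) * heat_kernel alpha t x)%:E)%E.

Definition resolvent_bound d alpha lambda (x : Rd[R]_d) : R :=
  if alpha < d%:R then normRd x `^ (alpha - d%:R)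
  else if alpha == d%:R then ln (1 + 1 / (lambda * normRd x)) + 1
  else Num.min (normRd x `^ (alpha - 1)) 1 + lambda `^ ((1 - alpha) / alpha).

End heat_semigroup.

(* Main.v *)
Require Import Defs.
From mathcomp Require Import all_boot all_order all_algebra.
From mathcomp Require Import all_classical all_reals all_analysis.
From mathcomp Require Import measurable_realfun lra ring.
Set Implicit Arguments.
Unset Strict Implicit.
Unset Printing Implicit Defensive.
Import Order.TTheory GRing.Theory Num.Theory.
Import numFieldNormedType.Exports.
Local Open Scope classical_set_scope.
Local Open Scope ring_scope.

(* Integrating [|p_t(x)| <= C * min (t `^ (- d / alpha)) (|x| `^ (- d))] against
   [expR (- lambda * t)] gives the three bounds, on splitting at
   [t = |x| `^ alpha] when [alpha <= d] and at [t = lambda^-1] when [alpha > d].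
   The first bound on [p_t] is the [L^1] norm of [expR (- t * |xi| `^ alpha)].
   For the second one, this symbol is a mixture of the Gaussians
   [expR (- u * |xi| ^+ 2)], [u >= 0], of total mass at most 1, and the Fourier
   transform of each of them at [x] is at most [K / |x| ^+ d] uniformly in [u].
   That [expR (- t * s `^ b)], [0 < b < 1], is a mixture of the [expR (- u * s)]
   is seen by writing [s] as the limit of [n * (1 - z)], [z := expR (- s / n)]:
   [expR (- t * (n * (1 - z)) `^ b)] is a power series in [z] with nonnegative
   coefficients because [1 - (1 - z) `^ b] is one. *)

(** The symbol is not smooth at the origin, so decay of its Fourier transform cannot be read off
    from repeated integration by parts; for a Gaussian the transform is explicit, and positivity of
    the mixture carries the bound over with no loss in the constant. A decay |x|^(-d) with no gain
    in [t] is enough: on an interval of length |x|^alpha it already integrates to |x|^(alpha - d).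

    Two regularisations are forced on the way. A mixture may charge [u = 0], whose exponential is
    the constant 1 and is not integrable on R^d, so the transform is estimated with an extra factor
    [expR (- (e * |xi| ^+ 2))], uniformly in [e > 0], and [e] tends to 0 only for the symbol itself,
    whose integrability is known separately. The binomial series is summed at [z < 1] only, so [s]
    is first shifted to [s + e] to keep [z] away from 1 when [s = 0]. *)

(** * Binomial series *)

Section binomial_series.
Context {R : realType}.
Variable b : R.
Hypotheses (b_ge0 : 0 <= b) (b_le1 : b <= 1).

(* The coefficients of [1 - (1 - z) `^ b = \sum_k binc k * z ^+ k.+1]. *)
Fixpoint binc (k : nat) : R :=
  if k is k'.+1 then binc k' * (k'.+1%:R - b) / k'.+2%:R else b.

Definition binsum (n : nat) (z : R) : R := \sum_(k < n) binc k * z ^+ k.+1.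

Definition dbinsum (n : nat) (z : R) : R :=
  \sum_(k < n) k.+1%:R * binc k * z ^+ k.

Lemma binc_ge0 k : 0 <= binc k.
Proof.
elim: k => //= k IH; rewrite divr_ge0// mulr_ge0// subr_ge0.
by rewrite (le_trans b_le1)// ler1n.
Qed.

Lemma binc_le k : k.+1%:R * binc k <= b.
Proof.
elim: k => [|k IH] /=; first by rewrite mul1r.
rewrite mulrCA mulfV ?pnatr_eq0// mulr1; apply: le_trans IH.
by rewrite mulrC ler_wpM2r ?binc_ge0// gerBl.
Qed.

(** The function 1 - (1 - z)^b solves (1 - z) y' + b y = b; the right-hand side shows the defect
    left by truncating its series after [n] terms. The identity is polynomial, so it may also be
    evaluated at [z = 1]. *)
Lemma binsum_ode n z :
  (1 - z) * dbinsum n z + b * binsum n z = b - n.+1%:R * binc n * z ^+ n.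
Proof.
elim: n => [|n IH].
  by rewrite /dbinsum /binsum !big_ord0 !mulr0 add0r mul1r expr0 mulr1 subrr.
rewrite /dbinsum /binsum !big_ord_recr /= -/(dbinsum n z) -/(binsum n z).
rewrite [(1 - z) * _]mulrDr [b * (_ + _)]mulrDr addrACA IH.
have e : n.+2%:R * (binc n * (n.+1%:R - b) / n.+2%:R) = binc n * (n.+1%:R - b).
  by rewrite mulrCA mulfV ?pnatr_eq0// mulr1.
by rewrite [in RHS]e exprS; ring.
Qed.

(** At [z = 1] the derivative drops out of [binsum_ode], leaving b times the sum equal to b minus a
    nonnegative defect. *)
Lemma sum_binc_le1 n : 0 < b -> \sum_(k < n) binc k <= 1.
Proof.
move=> b0; have := binsum_ode n 1.
rewrite subrr mul0r add0r expr1n mulr1 => /esym h.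
have -> : \sum_(k < n) binc k = binsum n 1.
  by apply: eq_bigr => k _; rewrite expr1n mulr1.
rewrite -(ler_pM2l b0) mulr1 -h gerBl.
by rewrite mulr_ge0 ?binc_ge0.
Qed.

Lemma is_derive_binsum (n : nat) (z : R) : is_derive z 1 (binsum n) (dbinsum n z).
Proof.
elim: n => [|n IH].
  rewrite /dbinsum big_ord0.
  rewrite (_ : binsum 0 = cst 0); first exact: is_derive_cst.
  by apply/funext => y; rewrite /binsum big_ord0.
rewrite /dbinsum big_ord_recr /= -/(dbinsum n z).
rewrite (_ : binsum n.+1 = binsum n \+ (fun y => binc n * y ^+ n.+1)); last first.
  by apply/funext => y; rewrite /binsum big_ord_recr.
apply: is_deriveD.
rewrite (_ : (fun _ => _) = binc n \*: (id ^+ n.+1)); last first.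
  by apply/funext => y; rewrite !fctE.
apply: is_derive_eq.
by rewrite scaler1 /GRing.scale /=; ring.
Qed.

Lemma is_derive_onem_powR (c z : R) : z < 1 ->
  is_derive z 1 (fun y => (1 - y) `^ c) (- (c * (1 - z) `^ (c - 1))).
Proof.
move=> z1; have h : 0 < 1 - z by rewrite subr_gt0.
have hin : 1 - z \in `]0%R, +oo[ by rewrite in_itv /= h.
have d1 : is_derive (1 - z) 1 (@powR R ^~ c) (c * (1 - z) `^ (c - 1)).
  apply: DeriveDef; first exact: derivable_powR.
  by rewrite -derive1E powR_derive1.
have := @is_derive1_comp R (@powR R ^~ c) (fun y => 1 - y) z _ (- 1) d1.
rewrite mulrN1; apply.
have := is_deriveB (is_derive_cst (1 : R) z 1) (is_derive_id z (1 : R)).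
by rewrite sub0r.
Qed.

(** The factor (1 - y)^(-b) is the integrating factor of the equation in [binsum_ode], so only the
    truncation defect survives in the derivative. *)
Lemma is_derive_binsum_ratio (n : nat) (z : R) : z < 1 ->
  is_derive z 1 (fun y => (1 - binsum n y) * (1 - y) `^ (- b))
    (n.+1%:R * binc n * z ^+ n * (1 - z) `^ (- b - 1)).
Proof.
move=> z1; have d1 := is_derive_binsum n z.
have d2 := is_derive_onem_powR (- b) z1.
have d0 := is_deriveB (is_derive_cst (1 : R) z 1) d1.
have d3 := is_deriveM d0 d2.
apply: (is_derive_eq d3).
rewrite /GRing.scale /=.
have e : (1 - z) `^ (- b) = (1 - z) * (1 - z) `^ (- b - 1).
  rewrite -{2}(@powRr1 _ (1 - z)); last by rewrite subr_ge0 ltW.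
  rewrite -powRD; first by congr (_ `^ _); ring.
  by apply/implyP => _; rewrite subr_eq0 gt_eqF.
rewrite e; have := binsum_ode n z; move: (_ `^ (- b - 1)) => w.
have -> : n.+1%:R * binc n * z ^+ n = b - ((1 - z) * dbinsum n z + b * binsum n z).
  by rewrite binsum_ode; ring.
by move=> _; rewrite (_ : (cst 1 - binsum n) z = 1 - binsum n z)//; ring.
Qed.

Lemma cvg_binsum z : 0 <= z < 1 -> binsum n z @[n --> \oo] --> 1 - (1 - z) `^ b.
Proof.
move=> /andP[z0 z1].
pose D n y := (1 - binsum n y) * (1 - y) `^ (- b).
have z10 : 0 < 1 - z by rewrite subr_gt0.
have D0 n : D n 0 = 1.
  rewrite /D /binsum big1 ?subr0 ?powR1 ?mulr1// => k _.
  by rewrite exprS mul0r mulr0.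
(* The mean value theorem on [0, z] gives [D n z - 1] as [z] times a derivative at some [c < z],
   where (n + 1) [binc n] is at most 1, c^n at most z^n, and (1 - c)^(-b-1) at most (1 -
   z)^(-b-1). *)
pose K := z * (1 - z) `^ (- b - 1).
have DB n : 1 <= D n z <= 1 + K * z ^+ n.
  have [zz|zn0] := eqVneq z 0.
    by rewrite zz D0 /K zz !mul0r addr0 lexx.
  have zp : 0 < z by rewrite lt_neqAle eq_sym zn0.
  have hd x : x \in `]0, z[ -> is_derive x 1 (D n)
      (n.+1%:R * binc n * x ^+ n * (1 - x) `^ (- b - 1)).
    rewrite in_itv /= => /andP[x0 xz].
    exact: is_derive_binsum_ratio (lt_trans xz z1).
  have hc : {within `[0, z], continuous (D n)}.
    apply: continuous_in_subspaceT => x; rewrite inE /= in_itv /= => /andP[x0 xz].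
    have [+ _] := is_derive_binsum_ratio n (le_lt_trans xz z1).
    by move=> /derivable1_diffP/differentiable_continuous.
  have [c cin] := MVT zp hd hc.
  rewrite D0 subr0 => /(canRL (subrK _)) ->.
  move: cin; rewrite in_itv /= => /andP[c0 cz].
  have c1 : 0 < 1 - c by rewrite subr_gt0 (lt_trans cz).
  have nn : 0 <= n.+1%:R * binc n * c ^+ n * (1 - c) `^ (- b - 1).
    by rewrite !mulr_ge0 ?binc_ge0 ?powR_ge0 ?exprn_ge0// ltW.
  rewrite lerDr mulr_ge0 ?(ltW zp)//= [leLHS]addrC lerD2l /K [leLHS]mulrC.
  rewrite -[leRHS]mulrA ler_wpM2l ?(ltW zp)// [leRHS]mulrC.
  rewrite ler_pM ?powR_ge0 ?mulr_ge0 ?binc_ge0 ?exprn_ge0 ?(ltW c0)//.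
    rewrite (@le_trans _ _ (1 * z ^+ n))//; last by rewrite mul1r.
    rewrite ler_pM ?mulr_ge0 ?binc_ge0 ?exprn_ge0 ?(ltW c0)//.
      exact: le_trans (binc_le n) b_le1.
    by rewrite lerXn2r ?nnegrE ?(ltW c0) ?(ltW cz) // ltW.
  rewrite -opprD !powRN lef_pV2 ?posrE ?powR_gt0//.
  rewrite ge0_ler_powR ?nnegrE ?(ltW z10) ?(ltW c1) //.
    by rewrite addr_ge0.
  by rewrite lerB// ltW.
have cD : D n z @[n --> \oo] --> (1 : R).
  apply: (@squeeze_cvgr _ _ _ _ (cst 1) (fun n => 1 + K * z ^+ n)).
  - by near=> n; exact: DB.
  - exact: cvg_cst.
  - rewrite -[X in _ --> X]addr0 -[X in _ + X](mulr0 K).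
    apply: cvgD; first exact: cvg_cst.
    apply: cvgMr; apply: cvg_expr.
    by rewrite ger0_norm.
have e n : binsum n z = 1 - D n z * (1 - z) `^ b.
  rewrite /D -mulrA -powRD.
    by rewrite addNr powRr0 mulr1; ring.
  by apply/implyP => _; rewrite gt_eqF.
under eq_fun do rewrite e.
apply: cvgB; first exact: cvg_cst.
by rewrite -[X in _ --> X]mul1r; apply: cvgMl.
Unshelve. all: by end_near. Qed.

End binomial_series.

(** * Mixtures of exponentials *)

Section exp_mixture.
Context {R : realType}.
Implicit Types (f g : R -> R) (M N : R).

(* [exp_mix M f] stands for "f is, on [0, +oo[, the Laplace transform of a
   positive measure of mass at most M"; closing finite combinations of
   exponentials under pointwise limits spares us Bernstein's theorem. *)
Inductive exp_mix : R -> (R -> R) -> Prop :=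
| exp_mix_expR u : 0 <= u -> exp_mix 1 (fun s => expR (- (u * s)))
| exp_mixZ c M f : 0 <= c -> exp_mix M f -> exp_mix (c * M) (fun s => c * f s)
| exp_mixD M N f g : exp_mix M f -> exp_mix N g ->
    exp_mix (M + N) (fun s => f s + g s)
| exp_mixW M N f : M <= N -> exp_mix M f -> exp_mix N f
| exp_mix_lim M F f : (forall n, exp_mix M (F n)) ->
    (forall s, 0 <= s -> F n s @[n --> \oo] --> f s) -> exp_mix M f.

Lemma exp_mix_ge0 M f : exp_mix M f -> 0 <= M.
Proof.
elim=> {M f} // [c M f c0 _ M0|M N f g _ M0 _ N0|M N f MN _ M0|M F f _ M0 _].
- exact: mulr_ge0.
- exact: addr_ge0.
- exact: le_trans MN.
- exact: (M0 0%N).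
Qed.

(** A constant sequence in [exp_mix_lim] already allows changing the function off [[0, +oo[]; this
    replaces functional extensionality throughout. *)
Lemma exp_mix_eq M f g :
  exp_mix M f -> (forall s, 0 <= s -> f s = g s) -> exp_mix M g.
Proof.
move=> Mf fg; apply: (@exp_mix_lim _ (fun=> f)) => // s s0.
by rewrite -fg//; exact: cvg_cst.
Qed.

Lemma exp_mix1 : exp_mix 1 (cst 1).
Proof.
by apply: exp_mix_eq (exp_mix_expR (lexx 0)) _ => s; rewrite mul0r oppr0 expR0.
Qed.

(** This is convolution of the two mixing measures, obtained by induction on each of the two
    derivations from the product of two exponentials. *)
Lemma exp_mixM M N f g : exp_mix M f -> exp_mix N g ->
  exp_mix (M * N) (fun s => f s * g s).
Proof.
move=> Mf; elim: Mf N g => {M f}.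
- move=> u u0 N g; elim=> {N g}.
  + move=> v v0; rewrite mul1r; apply: exp_mix_eq (exp_mix_expR (addr_ge0 u0 v0)) _.
    by move=> s; rewrite mulrDl opprD expRD.
  + move=> c M f c0 _ IH; rewrite mulrCA; apply: exp_mix_eq (exp_mixZ c0 IH) _.
    by move=> s; rewrite mulrCA.
  + move=> M N f g _ IHf _ IHg; rewrite mulrDr.
    by apply: exp_mix_eq (exp_mixD IHf IHg) _ => s; rewrite mulrDr.
  + by move=> M N f MN _; apply: exp_mixW; rewrite !mul1r.
  + move=> M F f _ IH Ff; apply: (exp_mix_lim IH) => s s0.
    exact: cvgMr (Ff _ s0).
- move=> c M f c0 _ IH N g Ng; rewrite -mulrA.
  by apply: exp_mix_eq (exp_mixZ c0 (IH _ _ Ng)) _ => s; rewrite mulrA.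
- move=> M M' f f' _ IH _ IH' N g Ng; rewrite mulrDl.
  by apply: exp_mix_eq (exp_mixD (IH _ _ Ng) (IH' _ _ Ng)) _ => s; rewrite mulrDl.
- move=> M M' f MM' _ IH N g Ng; apply: exp_mixW (IH _ _ Ng).
  by rewrite ler_wpM2r// (exp_mix_ge0 Ng).
- move=> M F f _ IH Ff N g Ng; apply: (exp_mix_lim (fun n => IH n _ _ Ng)) => s s0.
  exact: cvgMl (Ff _ s0).
Qed.

Lemma exp_mix_sum (M : nat -> R) (F : nat -> R -> R) n :
  (forall k, exp_mix (M k) (F k)) ->
  exp_mix (\sum_(k < n) M k) (fun s => \sum_(k < n) F k s).
Proof.
move=> MF; elim: n => [|n IH].
  rewrite big_ord0 -(mul0r 1); apply: exp_mix_eq (exp_mixZ (lexx 0) exp_mix1) _.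
  by move=> s; rewrite big_ord0 mul0r.
rewrite big_ord_recr /=; apply: exp_mix_eq (exp_mixD IH (MF n)) _.
by move=> s; rewrite big_ord_recr.
Qed.

Lemma exp_mixX M f n : exp_mix M f -> exp_mix (M ^+ n) (fun s => f s ^+ n).
Proof.
move=> Mf; elim: n => [|n IH]; first exact: exp_mix1.
rewrite exprS; apply: exp_mix_eq (exp_mixM Mf IH) _ => s.
by rewrite exprS.
Qed.

(** The partial sums of the exponential series of [f s] are mixtures, with masses the partial sums
    of the series of [expR M]. *)
Lemma exp_mix_expR_comp M f : exp_mix M f -> exp_mix (expR M) (fun s => expR (f s)).
Proof.
move=> Mf; pose F n s := \sum_(k < n) (k`!%:R^-1 * f s ^+ k).
apply: (@exp_mix_lim _ F) => [n|s _]; last first.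
  have := @is_cvg_series_exp_coeff R (f s).
  rewrite /expR; move/cvgP; apply: cvg_trans.
  rewrite (_ : F ^~ s = series (exp_coeff (f s))); first by [].
  apply/funext => n; rewrite /series /= big_mkord /F; apply: eq_bigr => k _.
  by rewrite /exp_coeff /= mulrC.
apply: exp_mixW (@exp_mix_sum (fun k => k`!%:R^-1 * M ^+ k)
  (fun k s => k`!%:R^-1 * f s ^+ k) n _); last first.
  by move=> k; apply: exp_mixZ; [rewrite invr_ge0|exact: exp_mixX].
have M0 := exp_mix_ge0 Mf.
have := @nondecreasing_cvgn_le R (series (exp_coeff M)) _ (is_cvg_series_exp_coeff M) n.
rewrite /series /= big_mkord => H.
apply: le_trans (H _); last first.
  apply: nondecreasing_series => k _ _; exact: exp_coeff_ge0.
by apply: ler_sum => k _; rewrite /exp_coeff /= mulrC.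
Qed.

(** Each power of z = [expR (- (u * (s + e)))] is an exponential in [s] of mass at most 1, and the
    coefficients [binc] sum to at most 1. The shift [e] gives z < 1 even at [s = 0], as [cvg_binsum]
    requires. *)
Lemma exp_mix_onem_powR (b e : R) : 0 < b -> b <= 1 -> 0 < e ->
  forall u, 0 < u ->
  exp_mix 1 (fun s => 1 - (1 - expR (- (u * (s + e)))) `^ b).
Proof.
move=> b0 b1 e0 u u0.
pose F (n : nat) (s : R) := binsum b n (expR (- (u * (s + e)))).
apply: (@exp_mix_lim _ F) => [n|s s0].
  apply: exp_mixW (sum_binc_le1 (ltW b0) b1 n b0) _.
  apply: (@exp_mix_sum (binc b) (fun k s => binc b k * expR (- (u * (s + e))) ^+ k.+1)) => k.
  rewrite -[X in exp_mix X]mulr1; apply: exp_mixZ; first exact: binc_ge0 (ltW b0) b1 k.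
  rewrite -(expr1n _ k.+1); apply: exp_mixX.
  apply: (@exp_mixW (expR (- (u * e)) * 1)).
    by rewrite mulr1 -expR0 ler_expR oppr_le0 mulr_ge0// ltW.
  apply: exp_mix_eq (exp_mixZ (expR_ge0 _) (exp_mix_expR (ltW u0))) _ => s.
  by rewrite -expRD -opprD -mulrDr addrC.
apply: cvg_binsum => //; first exact: ltW.
rewrite expR_ge0 /= -expR0 ltr_expR oppr_lt0 mulr_gt0//.
by rewrite (le_lt_trans s0)// ltrDl.
Qed.

(** Both squeezing bounds come from 1 + x <= e^x, applied to x and -x with x = s / (n + 1). *)
Lemma cvg_onem_expR (s : R) : 0 <= s ->
  n.+1%:R * (1 - expR (- (n.+1%:R^-1 * s))) @[n --> \oo] --> s.
Proof.
move=> s0.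
apply: (@squeeze_cvgr _ _ _ _ (fun n => s / (1 + n.+1%:R^-1 * s)) (cst s)).
- near=> n.
  have n0 : 0 < n.+1%:R :> R by rewrite ltr0n.
  have h0 : 0 < 1 + n.+1%:R^-1 * s.
    by rewrite (lt_le_trans ltr01)// lerDl mulr_ge0// invr_ge0 ltW.
  apply/andP; split; last first.
    rewrite -ler_pdivlMl// lerBlDr -lerBlDl.
    by rewrite (le_trans _ (expR_ge1Dx _)).
  rewrite -[X in X <= _](mulVKf (lt0r_neq0 n0)) ler_pM2l// lerBrDl.
  rewrite expRN.
  apply: (@le_trans _ _ ((1 + n.+1%:R^-1 * s)^-1 + n.+1%:R^-1 * (s / (1 + n.+1%:R^-1 * s)))).
    rewrite lerD2r lef_pV2 ?posrE ?expR_gt0//.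
    exact: expR_ge1Dx.
  rewrite mulrA -[X in X + _]mul1r -mulrDl mulfV// gt_eqF//.
- rewrite -[X in _ --> X]divr1; apply: cvgMr; apply: cvgV; first by rewrite oner_eq0.
  rewrite -[X in _ --> X]addr0 -[X in _ + X](mul0r s).
  apply: cvgD; first exact: cvg_cst.
  apply: cvgMl.
  exact: cvg_harmonic.
- exact: cvg_cst.
Unshelve. all: by end_near. Qed.

Lemma cvg_powR_nbhs (x b : R) : 0 < x -> y `^ b @[y --> x] --> x `^ b.
Proof.
move=> x0; have /derivable1_diffP/differentiable_continuous : derivable (@powR R ^~ b) x 1.
  by apply: derivable_powR; rewrite in_itv /= x0.
exact.
Qed.

Lemma cvgn_expR_comp (u : nat -> R) (l : R) :
  u n @[n --> \oo] --> l -> expR (u n) @[n --> \oo] --> expR l.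
Proof. by move=> ul; apply: continuous_cvg => //; exact: continuous_expR. Qed.

Lemma exp_mix_stable (b t : R) : 0 < b -> b <= 1 -> 0 <= t ->
  exp_mix 1 (fun s => expR (- t * s `^ b)).
Proof.
move=> b0 b1 t0.
(* The shift is removed in this outer limit; with the shift fixed, the inner limit in [n] only needs
   continuity of the power at a positive point. *)
apply: (@exp_mix_lim _ (fun m s => expR (- t * (s + m.+1%:R^-1) `^ b))) => [m|s s0].
  pose e : R := m.+1%:R^-1; have e0 : 0 < e by rewrite invr_gt0 ltr0n.
  pose y n s : R := n.+1%:R * (1 - expR (- (n.+1%:R^-1 * (s + e)))).
  apply: (@exp_mix_lim _ (fun n s => expR (- t * y n s `^ b))) => [n|s s0].
    have n0 : 0 < n.+1%:R^-1 :> R by rewrite invr_gt0 ltr0n.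
    have a0 : 0 <= t * n.+1%:R `^ b by rewrite mulr_ge0// powR_ge0.
    (* With a = t (n + 1)^b, the function is e^(-a) times the exponential of a (1 - (1 - z)^b). The
       latter has mass at most e^a, so the total mass is exactly brought back to 1. *)
    have H := exp_mixZ (expR_ge0 (- (t * n.+1%:R `^ b)))
      (exp_mix_expR_comp (exp_mixZ a0 (exp_mix_onem_powR b0 b1 e0 n0))).
    rewrite mulr1 -expRD addNr expR0 in H.
    apply: exp_mix_eq H _ => s s0.
    rewrite -expRD /y powRM ?ler0n//; last first.
      by rewrite subr_ge0 -expR0 ler_expR oppr_le0 mulr_ge0 ?(ltW n0)// addr_ge0// ltW.
    by congr expR; ring.
  have se0 : 0 < s + e by rewrite (le_lt_trans s0)// ltrDl.
  apply: cvgn_expR_comp.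
  apply: cvgMr.
  apply: (@cvg_comp _ _ _ (y ^~ s) (@powR R ^~ b)); last exact: cvg_powR_nbhs.
  exact: cvg_onem_expR (ltW se0).
apply: cvgn_expR_comp.
apply: cvgMr.
have cs : (s + m.+1%:R^-1) @[m --> \oo] --> s.
  rewrite -[X in _ --> X]addr0; apply: cvgD; first exact: cvg_cst.
  exact: cvg_harmonic.
have [->|sn0] := eqVneq s 0; last first.
  apply: (@cvg_comp _ _ _ _ (@powR R ^~ b) _ _ _ cs); apply: cvg_powR_nbhs.
  by rewrite lt_neqAle eq_sym sn0.
under eq_fun do rewrite add0r; rewrite powR0 ?gt_eqF//.
(* At [s = 0] the limit of the power is taken from the right, along the positive sequence
   [m.+1%:R^-1]. *)
have /cvg_at_rightP := powR_cvg0 b0; apply; split.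
  by move=> n; rewrite invr_gt0.
exact: cvg_harmonic.
Qed.

End exp_mixture.

(** * Gaussian integrals *)

Section real_integral.
Context d (T : measurableType d) (R : realType).
Variable mu : {measure set T -> \bar R}.
Local Open Scope ring_scope.

Lemma integrable_dominated (f g : T -> R) : measurable_fun setT f ->
  mu.-integrable setT (EFin \o g) -> (forall x, `|f x| <= g x) ->
  mu.-integrable setT (EFin \o f).
Proof.
move=> mf ig fg; apply: (le_integrable _ _ _ ig) => //.
  exact/measurable_EFinP.
move=> x _ /=; rewrite lee_fin (le_trans (fg x))//.
exact: ler_norm.
Qed.

Lemma integrable_EFinZl (k : R) (f : T -> R) :
  mu.-integrable setT (EFin \o f) -> mu.-integrable setT (EFin \o (fun x => k * f x)).
Proof.
move=> fi; rewrite (_ : _ \o _ = (fun x => k%:E * (EFin \o f) x)%E).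
  exact: integrableZl.
by apply/funext => x /=; rewrite EFinM.
Qed.

Lemma integrable_EFinB (f g : T -> R) :
  mu.-integrable setT (EFin \o f) -> mu.-integrable setT (EFin \o g) ->
  mu.-integrable setT (EFin \o (fun x => f x - g x)).
Proof.
move=> fi gi.
rewrite (_ : _ \o _ = (fun x => (EFin \o f) x - (EFin \o g) x)%E).
  exact: integrableB.
by apply/funext => x /=; rewrite EFinB.
Qed.

Lemma dominated_cvg_Rintegral (F : nat -> T -> R) (f g : T -> R) :
  (forall n, measurable_fun setT (F n)) ->
  (forall x, F n x @[n --> \oo] --> f x) ->
  mu.-integrable setT (EFin \o g) -> (forall n x, `|F n x| <= g x) ->
  mu.-integrable setT (EFin \o f) /\
  (\int[mu]_x F n x)%R @[n --> \oo] --> (\int[mu]_x f x)%R.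
Proof.
move=> mF Ff ig Fg.
have mf : measurable_fun setT f.
  by apply: (@measurable_fun_cvg _ _ _ _ F f) => // x _; exact: Ff.
have [||||h1 _ h2] := @dominated_convergence _ _ _ mu setT measurableT
  (fun n x => (F n x)%:E) (EFin \o f) (EFin \o g) _ _ _ ig.
- by move=> n; exact/measurable_EFinP.
- exact/measurable_EFinP.
- by apply/aeW => x _; apply: cvg_EFin (Ff x); exact: nearW.
- by apply/aeW => x n _; rewrite /= lee_fin.
split => //; apply: fine_cvg; rewrite fineK//.
exact: integrable_fin_num.
Qed.

Lemma norm_Rintegral_le (f g : T -> R) : measurable_fun setT f ->
  mu.-integrable setT (EFin \o g) -> (forall x, `|f x| <= g x) ->
  `|\int[mu]_x f x| <= \int[mu]_x g x.
Proof.
move=> mf ig fg; have fi := integrable_dominated mf ig fg.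
apply: le_trans (le_normr_Rintegral measurableT fi) _.
apply: le_Rintegral => //.
exact: (integrable_norm fi).
Qed.

End real_integral.

Section integral_derivative.
Context {R : realType}.
Let mu := @lebesgue_measure R.

(** The fundamental theorem of calculus is applied on symmetric intervals exhausting the line; the
    truncations of [h] are dominated by its absolute value. *)
Lemma Rintegral_derive_eq0 (H h : measurableTypeR R -> R) : continuous h ->
  (forall x : R, is_derive x 1 H (h x)) -> mu.-integrable setT (EFin \o h) ->
  H n.+1%:R @[n --> \oo] --> (0 : R) -> H (- (n.+1%:R)) @[n --> \oo] --> (0 : R) ->
  \int[mu]_x h x = 0.
Proof.
move=> ch dH ih Hp Hn.
have cH : continuous H.
  by move=> x; have [+ _] := dH x => /derivable1_diffP/differentiable_continuous.
pose I (n : nat) := [set` `[- (n.+1%:R : R), n.+1%:R]].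
have e n : \int[mu]_x ((h \_ (I n)) x) = H n.+1%:R - H (- (n.+1%:R)).
  rewrite -Rintegral_mkcond /Rintegral (@continuous_FTC2 _ h H)//.
  - by rewrite gtrN// ltr0n.
  - exact: continuous_subspaceT.
  - split; last 2 first.
    + by apply: cvg_at_right_filter; exact: cH.
    + by apply: cvg_at_left_filter; exact: cH.
    + by move=> x _; have [] := dH x.
  - by move=> x _; rewrite derive1E; have [_ ->] := dH x.
have mI n : measurable_fun [set: measurableTypeR R] (h \_ (I n)).
  apply/(measurable_restrictT _ _).1 => //.
    exact: measurable_itv.
  by apply: measurable_funTS; exact: continuous_measurable_fun.
have cI x : (h \_ (I n)) x @[n --> \oo] --> h x.
  apply: cvg_near_cst; near=> n.
  rewrite patchE mem_set// /I /= in_itv /= -ler_norml.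
  near: n; exists (Num.truncn `|x|) => // n /= xn.
  rewrite (le_trans (ltW (truncnS_gt _)))// ler_nat ltnS.
  exact: xn.
have bI n x : `|(h \_ (I n)) x| <= `|h x|.
  by rewrite patchE; case: ifP => // _; rewrite normr0.
have [_] := dominated_cvg_Rintegral mI cI (integrable_norm ih) bI.
under eq_fun do rewrite e.
move=> c1; have := cvgB Hp Hn; rewrite subrr => c2.
by rewrite -(cvg_lim _ c1)//; apply: cvg_lim => //; exact: c2.
Unshelve. all: by end_near. Qed.

End integral_derivative.

Section gaussian_fourier.
Context {R : realType}.
Let mu := @lebesgue_measure R.
Implicit Types u x y th : R.

Definition gauss u y : R := expR (- (u * y ^+ 2)).

Lemma gauss_ge0 u y : 0 <= gauss u y. Proof. exact: expR_ge0. Qed.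

Lemma continuous_gauss u : continuous (gauss u).
Proof.
move=> y; rewrite /continuous_at /gauss; apply: continuous_cvg.
  exact: continuous_expR.
by apply: cvgN; apply: cvgMr; exact: exprn_continuous.
Qed.

Lemma measurable_gauss u : measurable_fun [set: measurableTypeR R] (gauss u).
Proof. exact: continuous_measurable_fun (@continuous_gauss u). Qed.

(** Variance 1 / (2u) matches the exponent, so integrability and total mass are inherited from the
    normal density. *)
Lemma gauss_normal u : 0 < u ->
  gauss u = fun y => Num.sqrt (pi / u) * normal_pdf 0 (Num.sqrt (2 * u)^-1) y.
Proof.
move=> u0; apply/funext => y.
have s0 : Num.sqrt (2 * u)^-1 != 0 by rewrite gt_eqF// sqrtr_gt0 invr_gt0 mulr_gt0.
rewrite normal_pdfE// /normal_peak /normal_fun sqr_sqrtr; last first.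
  by rewrite invr_ge0 mulr_ge0// ltW.
have u0' := lt0r_neq0 u0.
have -> : ((2 * u)^-1 * pi *+ 2) = pi / u :> R by field.
rewrite mulrA mulfV ?mul1r; last by rewrite gt_eqF// sqrtr_gt0 divr_gt0// pi_gt0.
by rewrite /gauss; congr expR; field.
Qed.

Lemma integrable_gauss u : 0 < u -> mu.-integrable setT (EFin \o gauss u).
Proof.
move=> u0; rewrite (gauss_normal u0).
by apply: integrable_EFinZl; exact: integrable_normal_pdf.
Qed.

Lemma integral_gauss u : 0 < u -> \int[mu]_y gauss u y = Num.sqrt (pi / u).
Proof.
move=> u0; rewrite (gauss_normal u0) RintegralZl//; last exact: integrable_normal_pdf.
by rewrite /Rintegral integral_normal_pdf mulr1.
Qed.

(** Half of the Gaussian absorbs the factor [y]: |y| <= 1 + y^2 <= (1 + 2/u)(1 + (u/2) y^2), and the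
    last factor is at most the exponential of (u/2) y^2. *)
Lemma normM_gauss_le u y : 0 < u -> `|y * gauss u y| <= (1 + 2 / u) * gauss (u / 2) y.
Proof.
move=> u0.
have -> : gauss u y = gauss (u / 2) y * gauss (u / 2) y.
  by rewrite /gauss -expRD; congr expR; field.
rewrite mulrA normrM (ger0_norm (gauss_ge0 _ _)) ler_wpM2r ?gauss_ge0//.
rewrite normrM (ger0_norm (gauss_ge0 _ _)) /gauss expRN.
rewrite ler_pdivrMr ?expR_gt0//.
apply: (@le_trans _ _ ((1 + 2 / u) * (1 + u / 2 * y ^+ 2))); last first.
  by rewrite ler_wpM2l ?expR_ge1Dx// addr_ge0// divr_ge0// ltW.
have -> : (1 + 2 / u) * (1 + u / 2 * y ^+ 2) = 1 + 2 / u + (u / 2 + 1) * y ^+ 2.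
  by field; rewrite gt_eqF.
have yy : `|y| <= 1 + y ^+ 2.
  rewrite -real_normK ?num_real//.
  have := sqr_ge0 (`|y| - 1); have := normr_ge0 y; nra.
apply: le_trans yy _; rewrite lerD//.
  by rewrite lerDl divr_ge0// ltW.
by rewrite ler_peMl ?sqr_ge0// lerDr divr_ge0// ltW.
Qed.

Lemma integrableM_gauss u : 0 < u -> mu.-integrable setT (EFin \o (fun y => y * gauss u y)).
Proof.
move=> u0; have u20 : 0 < u / 2 by rewrite divr_gt0.
apply: integrable_dominated (integrable_EFinZl (1 + 2 / u) (integrable_gauss u20)) _.
  by apply: measurable_funM => //; exact: measurable_gauss.
by move=> y; exact: normM_gauss_le.
Qed.

Lemma continuous_phase x th : continuous (fun y : R => x * y + th).
Proof.
move=> y; rewrite /continuous_at; apply: cvgD; last exact: cvg_cst.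
by apply: cvgMr; exact: cvg_id.
Qed.

Lemma continuous_cos_phase x th : continuous (fun y : R => cos (x * y + th)).
Proof.
move=> y; rewrite /continuous_at; apply: continuous_cvg; first exact: continuous_cos.
exact: continuous_phase.
Qed.

Lemma continuous_sin_phase x th : continuous (fun y : R => sin (x * y + th)).
Proof.
move=> y; rewrite /continuous_at; apply: continuous_cvg; first exact: continuous_sin.
exact: continuous_phase.
Qed.

Lemma norm_cos_le1 x : `|cos x| <= 1.
Proof. by rewrite ler_norml cos_geN1 cos_le1. Qed.

Lemma norm_sin_le1 x : `|sin x| <= 1.
Proof. by rewrite ler_norml sin_geN1 sin_le1. Qed.

Lemma integrable_cos_gauss u x th : 0 < u ->
  mu.-integrable setT (EFin \o (fun y => cos (x * y + th) * gauss u y)).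
Proof.
move=> u0; apply: integrable_dominated (integrable_gauss u0) _ => [|y].
  apply: measurable_funM; last exact: measurable_gauss.
  exact: continuous_measurable_fun (@continuous_cos_phase x th).
by rewrite normrM (ger0_norm (gauss_ge0 _ _)) ler_piMl ?gauss_ge0// norm_cos_le1.
Qed.

Lemma integrable_sinM_gauss u x th : 0 < u ->
  mu.-integrable setT (EFin \o (fun y => sin (x * y + th) * (y * gauss u y))).
Proof.
move=> u0; apply: integrable_dominated (integrable_norm (integrableM_gauss u0)) _ => [|y].
  apply: measurable_funM.
    exact: continuous_measurable_fun (@continuous_sin_phase x th).
  by apply: measurable_funM => //; exact: measurable_gauss.
by rewrite normrM /= ler_piMl ?norm_sin_le1.
Qed.

Lemma is_derive_gauss u y :
  is_derive y 1 (gauss u) (- (2 * u * y) * gauss u y).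
Proof.
rewrite /gauss.
have dq : is_derive y 1 (fun y : R => - (u * y ^+ 2)) (- (2 * u * y)).
  have -> : (fun y : R => - (u * y ^+ 2)) = - (u \*: (id ^+ 2)) by apply/funext => z; rewrite !fctE.
  by apply: is_derive_eq; rewrite /GRing.scale /=; ring.
have := @is_derive1_comp R expR (fun y : R => - (u * y ^+ 2)) y _ _ (is_derive_expR _) dq.
by rewrite mulrC.
Qed.

Lemma is_derive_sin_phase x th y :
  is_derive y 1 (fun y : R => sin (x * y + th)) (x * cos (x * y + th)).
Proof.
have dq : is_derive y 1 (fun y : R => x * y + th) x.
  have -> : (fun y : R => x * y + th) = (x \*: id) + cst th by apply/funext => z; rewrite !fctE.
  by apply: is_derive_eq; rewrite /GRing.scale /=; ring.
have := @is_derive1_comp R sin (fun y : R => x * y + th) y _ _ (is_derive_sin _) dq.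
by rewrite mulrC.
Qed.

Lemma gauss_bound u y : 0 < u -> gauss u y <= (1 + u * y ^+ 2)^-1.
Proof.
move=> u0; rewrite /gauss expRN lef_pV2 ?posrE ?expR_gt0 ?expR_ge1Dx//.
by rewrite (lt_le_trans ltr01)// lerDl mulr_ge0 ?sqr_ge0 ?ltW.
Qed.

(** The sign [s] treats both ends of the line at once, for the boundary terms of
    [gauss_by_parts]. *)
Lemma cvg_bounded_gauss u (f : nat -> R) (s : R) : 0 < u -> s ^+ 2 = 1 ->
  (forall n, `|f n| <= 1) ->
  f n * gauss u (s * n.+1%:R) @[n --> \oo] --> (0 : R).
Proof.
move=> u0 s1 f1; apply/norm_cvg0P.
apply: (@squeeze_cvgr _ _ _ _ (cst 0) (fun n => u^-1 * n.+1%:R^-1)).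
- near=> n; rewrite normr_ge0 /= normrM (ger0_norm (gauss_ge0 _ _)).
  apply: (@le_trans _ _ (1 * gauss u (s * n.+1%:R))).
    by rewrite ler_wpM2r ?gauss_ge0.
  rewrite mul1r (le_trans (gauss_bound _ u0))// -invfM lef_pV2 ?posrE; last 2 first.
  + by rewrite (lt_le_trans ltr01)// lerDl mulr_ge0 ?sqr_ge0 ?ltW.
  + by rewrite mulr_gt0.
  rewrite exprMn s1 mul1r (@le_trans _ _ (u * n.+1%:R ^+ 2))//; last by rewrite lerDr.
  by rewrite ler_pM2l// expr2 ler_peMl// ler1n.
- exact: cvg_cst.
- rewrite -[X in _ --> X](mulr0 u^-1); apply: cvgMr; exact: cvg_harmonic.
Unshelve. all: by end_near. Qed.

(** The derivative of sin(xy + th) [gauss u y] integrates to zero. The identity turns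
    differentiation of the transform in [x] into multiplication by -x / (2u). *)
Lemma gauss_by_parts u x th : 0 < u ->
  \int[mu]_y (sin (x * y + th) * (y * gauss u y)) =
  x / (2 * u) * \int[mu]_y (cos (x * y + th) * gauss u y).
Proof.
move=> u0.
pose H (y : R) := sin (x * y + th) * gauss u y.
pose h (y : R) := x * (cos (x * y + th) * gauss u y)
  - 2 * u * (sin (x * y + th) * (y * gauss u y)).
have i1 := integrable_EFinZl x (integrable_cos_gauss x th u0).
have i2 := integrable_EFinZl (2 * u) (integrable_sinM_gauss x th u0).
have h0 : \int[mu]_y h y = 0.
  apply: (@Rintegral_derive_eq0 _ H).
  - move=> y; rewrite /continuous_at /h; apply: cvgB; apply: cvgMr; apply: cvgM.
    + exact: continuous_cos_phase.
    + exact: continuous_gauss.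
    + exact: continuous_sin_phase.
    + by apply: cvgM; [exact: cvg_id|exact: continuous_gauss].
  - move=> y.
    have := is_deriveM (is_derive_sin_phase x th y) (is_derive_gauss u y).
    by move=> d; apply: (is_derive_eq d); rewrite /GRing.scale /h /=; ring.
  - exact: integrable_EFinB i1 i2.
    - have := @cvg_bounded_gauss u (fun n => sin (x * n.+1%:R + th)) 1 u0 (expr1n _ _) _.
    by under eq_fun do rewrite mul1r; apply => n; exact: norm_sin_le1.
  - have := @cvg_bounded_gauss u (fun n => sin (x * - n.+1%:R + th)) (- 1) u0 _ _.
    under eq_fun do rewrite mulN1r; apply; first by rewrite sqrrN expr1n.
    by move=> n; exact: norm_sin_le1.
move: h0; rewrite /h RintegralB// !RintegralZl//; last 2 first.
  exact: integrable_sinM_gauss.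
  exact: integrable_cos_gauss.
move/eqP; rewrite subr_eq0 => /eqP e.
apply: (@mulfI _ (2 * u)); first by rewrite mulf_neq0// gt_eqF.
by rewrite -e; field; rewrite gt_eqF.
Qed.

Lemma is_derive_cos_gauss u th x y :
  is_derive x 1 (fun x : R => cos (x * y + th) * gauss u y)
    (- (sin (x * y + th) * (y * gauss u y))).
Proof.
have dq : is_derive x 1 (fun x : R => x * y + th) y.
  have -> : (fun x : R => x * y + th) = (y \*: id) + cst th.
    by apply/funext => z; rewrite !fctE mulrC.
  by apply: is_derive_eq; rewrite /GRing.scale /=; ring.
have dc := @is_derive1_comp R cos (fun x : R => x * y + th) x _ _ (is_derive_cos _) dq.
have -> : (fun x : R => cos (x * y + th) * gauss u y) =
    gauss u y \*: (cos \o (fun x : R => x * y + th)).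
  by apply/funext => z; rewrite !fctE mulrC.
by apply: is_derive_eq; rewrite /GRing.scale /=; ring.
Qed.

Lemma is_derive_gauss_fourier u th x : 0 < u ->
  is_derive x 1 (fun x => \int[mu]_y (cos (x * y + th) * gauss u y))
    (- (x / (2 * u)) * \int[mu]_y (cos (x * y + th) * gauss u y)).
Proof.
move=> u0.
pose f x (y : measurableTypeR R) : R := cos (x * y + th) * gauss u y.
have xI : (`]x - 1, x + 1[%classic : set R) x.
  by rewrite /= in_itv /= ltrBlDr !ltrDl ltr01.
have d1E z (y : measurableTypeR R) : partial1of2 f z y = - (sin (z * y + th) * (y * gauss u y)).
  by rewrite partial1of2E; have [_ ->] := is_derive_cos_gauss u th z y.
have i2 : forall z, `]x - 1, x + 1[%classic z -> mu.-integrable setT (EFin \o f z).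
  by move=> z _; exact: integrable_cos_gauss.
have i3 : forall z y, `]x - 1, x + 1[%classic z -> setT y -> derivable (f ^~ y) z 1.
  by move=> z y _ _; have [] := is_derive_cos_gauss u th z y.
have i4 : forall y : measurableTypeR R, 0 <= `|y * gauss u y| by [].
have i5 : forall z (y : measurableTypeR R), `]x - 1, x + 1[%classic z -> setT y ->
    `|partial1of2 f z y| <= `|y * gauss u y|.
  by move=> z y _ _; rewrite d1E normrN normrM ler_piMl// norm_sin_le1.
have ig := integrable_norm (integrableM_gauss u0).
have dd := derivable_under_integral measurableT xI i2 i3 i4 ig i5.
apply: DeriveDef; first exact: dd.
rewrite -derive1E (differentiation_under_integral measurableT xI i2 i3 i4 ig i5).
under eq_Rintegral do rewrite d1E -mulN1r.
rewrite RintegralZl//; last exact: integrable_sinM_gauss.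
by rewrite gauss_by_parts// mulN1r mulNr.
Qed.

(** The transform solves F' = -(x / (2u)) F, so its product with the inverse Gaussian in [x] is
    constant and is evaluated at 0. The free phase [th] lets the dimension be raised with cosine
    integrals alone. *)
Lemma gauss_fourier u th x : 0 < u ->
  \int[mu]_y (cos (x * y + th) * gauss u y) =
  cos th * (Num.sqrt (pi / u) * expR (- (x ^+ 2 / (4 * u)))).
Proof.
move=> u0.
pose F x := \int[mu]_y (cos (x * y + th) * gauss u y).
pose E x := expR (x ^+ 2 / (4 * u)).
have dE (z : R) : is_derive z 1 E (z / (2 * u) * E z).
  have dq : is_derive z 1 (fun z : R => z ^+ 2 / (4 * u)) (z / (2 * u)).
    have -> : (fun z : R => z ^+ 2 / (4 * u)) = (4 * u)^-1 \*: (id ^+ 2).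
      by apply/funext => w; rewrite !fctE mulrC.
    apply: is_derive_eq; rewrite /GRing.scale /=; field.
    by rewrite gt_eqF.
  have := @is_derive1_comp R expR (fun z : R => z ^+ 2 / (4 * u)) z _ _ (is_derive_expR _) dq.
  by move=> dE; apply: (is_derive_eq dE); exact: mulrC.
have dFE (z : R) : is_derive z 1 (F * E) 0.
  have dF := is_derive_gauss_fourier th z u0.
  apply: (is_derive_eq (is_deriveM dF (dE z))).
  by rewrite /GRing.scale /= -/(F z); ring.
have := is_derive_0_is_cst x 0 dFE.
rewrite !fctE /E expr0n /= mul0r expR0 mulr1 => e.
rewrite expRN mulrA -[LHS]/(F x).
apply: (canRL (mulfK _)); first by rewrite gt_eqF// expR_gt0.
rewrite e /F; under eq_Rintegral do rewrite mul0r add0r.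
by rewrite RintegralZl ?integral_gauss//; exact: integrable_gauss.
Qed.

End gaussian_fourier.

(** * Integrals over R^d *)

Section lebesgue_Rd_integral.
Context {R : realType}.
Let mu := @lebesgue_measure R.
Local Notation leb d := (@lebesgue_Rd R d).

Lemma ge0_integral_RdS n (f : Rd[R]_n.+1 -> \bar R) :
  measurable_fun setT f -> (forall y, (0 <= f y)%E) ->
  (\int[leb n.+1]_y f y = \int[mu]_a \int[leb n]_y f (tcons (a, y)))%E.
Proof.
move=> mf f0.
have := @ge0_integral_pushforward _ _ _ _ R _ (@measurable_tcons R n)
  (@lebesgue_measure R \x leb n)%E setT f measurableT mf (fun y _ => f0 y).
rewrite preimage_setT => h; rewrite [LHS]h.
rewrite fubini_tonelli1//; last by move=> x; exact: f0.
by apply: measurableT_comp => //; exact: measurable_tcons.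
Qed.

(** Integrability is assumed on every slice, not just almost every one, so that the real-valued
    inner integral agrees pointwise with the extended one in Fubini's theorem. *)
Lemma integral_RdS n (f : Rd[R]_n.+1 -> R) :
  (leb n.+1).-integrable setT (EFin \o f) ->
  (forall a, (leb n).-integrable setT (fun y => (f (tcons (a, y)))%:E)) ->
  \int[leb n.+1]_y f y = \int[mu]_a \int[leb n]_y f (tcons (a, y)).
Proof.
move=> fi fai.
have mf := measurable_int _ fi.
have fpi : (@lebesgue_measure R \x leb n)%E.-integrable setT ((EFin \o f) \o @tcons R n).
  apply/integrableP; split.
    by apply: measurableT_comp => //; exact: measurable_tcons.
  move/integrableP : fi => [_]; rewrite ge0_integral_RdS//; last first.
    exact: measurableT_comp.
  by rewrite -(fubini_tonelli1 (abse \o ((EFin \o f) \o @tcons R n)))//=;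
    do 2 apply: measurableT_comp => //; exact: measurable_tcons.
have := @integral_pushforward _ _ _ _ R _ (@measurable_tcons R n)
  (@lebesgue_measure R \x leb n)%E setT (EFin \o f) mf.
rewrite preimage_setT => /(_ fpi measurableT) h.
rewrite /Rintegral [in LHS]h -integral12_prod_meas1//.
congr fine; apply: eq_integral => a _.
by rewrite /fubini_F fineK//; exact: integrable_fin_num.
Qed.

Definition prodRd d (g : R -> R) (y : Rd[R]_d) : R := \prod_(i < d) g (tnth y i).

Lemma prodRd_tcons n (g : R -> R) a (y : Rd[R]_n) :
  prodRd g (tcons (a, y)) = g a * prodRd g y.
Proof.
rewrite /prodRd big_ord_recl tnth0; congr *%R.
by apply: eq_bigr => i _; rewrite tnthS.
Qed.

Lemma measurable_prodRd d (g : R -> R) : measurable_fun [set: measurableTypeR R] g ->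
  measurable_fun setT (@prodRd d g).
Proof.
move=> mg; apply: measurable_prod => i _.
by apply: measurableT_comp => //; exact: measurable_tnth.
Qed.

Lemma prodRd_ge0 d (g : R -> R) (y : Rd[R]_d) : (forall a, 0 <= g a) -> 0 <= prodRd g y.
Proof. by move=> g0; apply: prodr_ge0. Qed.

Lemma integral_prodRd d (g : R -> R) : (forall a, 0 <= g a) ->
  mu.-integrable setT (EFin \o g) ->
  (\int[leb d]_y (prodRd g y)%:E = ((\int[mu]_a g a) ^+ d)%:E)%E.
Proof.
move=> g0 gi.
have mg : measurable_fun [set: measurableTypeR R] g.
  by apply/measurable_EFinP; exact: measurable_int gi.
have I0 n : 0 <= (\int[mu]_a g a) ^+ n by rewrite exprn_ge0// Rintegral_ge0.
elim: d => [|n IH].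
  rewrite expr0 [LHS](_ : _ = (\int[\d_([tuple] : Rd[R]_0)]_y (prodRd g y)%:E)%E)//.
  rewrite integral_dirac//; last first.
    by apply/measurable_EFinP; exact: measurable_prodRd.
  by rewrite diracT mul1e /prodRd big_ord0.
rewrite ge0_integral_RdS; last 2 first.
  by apply/measurable_EFinP; exact: measurable_prodRd.
  by move=> y; rewrite lee_fin prodRd_ge0.
under eq_integral => a _.
  under eq_integral do rewrite prodRd_tcons EFinM.
  rewrite ge0_integralZl_EFin//; last 2 first.
    by move=> y _; rewrite lee_fin prodRd_ge0.
    by apply/measurable_EFinP; exact: measurable_prodRd.
  rewrite IH.
  over.
rewrite ge0_integralZr//; last 3 first.
  exact/measurable_EFinP.
  by move=> a _; rewrite lee_fin.
  by rewrite lee_fin.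
rewrite exprS EFinM; congr (_ * _)%E.
by rewrite fineK//; exact: integrable_fin_num.
Qed.

Lemma integrable_prodRd d (g : R -> R) : (forall a, 0 <= g a) ->
  mu.-integrable setT (EFin \o g) ->
  (leb d).-integrable setT (EFin \o @prodRd d g).
Proof.
move=> g0 gi; apply/integrableP; split.
  apply/measurable_EFinP; apply: measurable_prodRd.
  by apply/measurable_EFinP; exact: measurable_int gi.
under eq_integral do rewrite /= ger0_norm ?prodRd_ge0//.
by rewrite integral_prodRd// ltry.
Qed.

Lemma dotRd_tcons n a b (x y : Rd[R]_n) :
  dotRd (tcons (a, x)) (tcons (b, y)) = a * b + dotRd x y.
Proof.
rewrite /dotRd big_ord_recl !tnth0; congr +%R.
by apply: eq_bigr => i _; rewrite !tnthS.
Qed.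

Lemma measurable_dotRd d (x : Rd[R]_d) : measurable_fun setT (dotRd x).
Proof.
apply: measurable_sum => i; apply: measurable_funM => //.
exact: measurable_tnth.
Qed.

Lemma measurable_dotRdxx d : measurable_fun setT (fun y : Rd[R]_d => dotRd y y).
Proof.
by apply: measurable_sum => i; apply: measurable_funM; exact: measurable_tnth.
Qed.

Lemma dotRdxx_ge0 d (x : Rd[R]_d) : 0 <= dotRd x x.
Proof. by apply: sumr_ge0 => i _; rewrite -expr2 sqr_ge0. Qed.

Lemma prodRd_gauss d u (y : Rd[R]_d) : prodRd (gauss u) y = expR (- (u * dotRd y y)).
Proof.
rewrite /prodRd /dotRd mulr_sumr -sumrN expR_sum.
by apply: eq_bigr => i _; rewrite -expr2.
Qed.

Lemma measurable_cos_dotRd d (x : Rd[R]_d) th :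
  measurable_fun setT (fun y => cos (dotRd x y + th)).
Proof.
apply: measurableT_comp; first exact: continuous_measurable_fun (@continuous_cos R).
by apply: measurable_funD => //; exact: measurable_dotRd.
Qed.

Lemma integrable_cos_prodRd d (x : Rd[R]_d) th u : 0 < u ->
  (leb d).-integrable setT (EFin \o (fun y => cos (dotRd x y + th) * prodRd (gauss u) y)).
Proof.
move=> u0; have i := integrable_prodRd d (gauss_ge0 u) (integrable_gauss u0).
apply: integrable_dominated i _.
  apply: measurable_funM; first exact: measurable_cos_dotRd.
  exact: measurable_prodRd (@measurable_gauss _ u).
move=> y; rewrite normrM (ger0_norm (prodRd_ge0 _ (gauss_ge0 u))).
by rewrite ler_piMl ?norm_cos_le1// prodRd_ge0// => a; exact: gauss_ge0.
Qed.

(** In the induction, the contribution of the first coordinate to the argument of the cosine is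
    moved into the phase of the remaining ones, and comes back out as the factor cos(b a + th). *)
Lemma gauss_fourier_Rd d (x : Rd[R]_d) th u : 0 < u ->
  \int[leb d]_y (cos (dotRd x y + th) * expR (- (u * dotRd y y))) =
  cos th * (Num.sqrt (pi / u) ^+ d * expR (- (dotRd x x / (4 * u)))).
Proof.
move=> u0; under eq_Rintegral do rewrite -prodRd_gauss.
elim: d x th => [|n IH] x th.
  rewrite [LHS](_ : _ = fine (\int[\d_([tuple] : Rd[R]_0)]_y
    (cos (dotRd x y + th) * prodRd (gauss u) y)%:E)%E)//.
  rewrite integral_dirac//; last first.
    apply/measurable_EFinP; apply: measurable_funM; first exact: measurable_cos_dotRd.
    exact: measurable_prodRd (@measurable_gauss _ u).
  by rewrite diracT mul1e /= /prodRd /dotRd !big_ord0 mul0r oppr0 expR0 add0r expr0 !mulr1.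
case/tupleP: x => b x; rewrite -[[tuple of b :: x]]/(tcons (b, x)).
have e a y : cos (dotRd (tcons (b, x)) (tcons (a, y)) + th) * prodRd (gauss u) (tcons (a, y))
    = gauss u a * (cos (dotRd x y + (b * a + th)) * prodRd (gauss u) y).
  by rewrite dotRd_tcons prodRd_tcons addrAC [X in cos X]addrC addrA; ring.
rewrite integral_RdS; last 2 first.
  exact: integrable_cos_prodRd.
  move=> a; under eq_fun do rewrite e.
  exact: (integrable_EFinZl _ (integrable_cos_prodRd _ _ u0)).
under eq_Rintegral => a _.
  under eq_Rintegral do rewrite e.
  rewrite RintegralZl//; last exact: integrable_cos_prodRd.
  rewrite IH mulrA [X in X * _]mulrC.
  over.
rewrite RintegralZr//; last exact: integrable_cos_gauss.
rewrite gauss_fourier// dotRd_tcons -expr2.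
have eD (A B c : R) : - ((A + B) / c) = - (A / c) + - (B / c) by rewrite mulrDl opprD.
by rewrite eD expRD [_ ^+ n.+1]exprS; ring.
Qed.

End lebesgue_Rd_integral.

(** * Fourier transforms of mixtures of Gaussians *)

Section exp_mix_fourier.
Context {R : realType}.
Local Notation leb d := (@lebesgue_Rd R d).

Lemma normRd_gt0 d (x : Rd[R]_d) : x != Rd0 d -> 0 < normRd x.
Proof.
move=> x0; rewrite sqrtr_gt0 lt_neqAle dotRdxx_ge0 andbT eq_sym.
apply: contra x0 => /eqP e; apply/eqP/eq_from_tnth => i.
rewrite tnth_mktuple.
have x2_ge0 (j : 'I_d) : true -> 0 <= tnth x j * tnth x j by rewrite -expr2 sqr_ge0.
have h : tnth x i * tnth x i = 0 by exact: psumr_eq0P x2_ge0 e i isT.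
by move/eqP : h; rewrite mulf_eq0 orbb => /eqP.
Qed.

(** The factor d! bounds s^d e^(-s) for s >= 0; the square root undoes the squaring in
    [gauss_fourier_le]. *)
Definition gauss_const d : R := Num.sqrt ((4 * pi) ^+ d * d`!%:R).

Lemma expr_le_expR n (s : R) : 0 <= s -> s ^+ n <= n`!%:R * expR s.
Proof.
case: n => [|n] s0; first by rewrite expr0 mul1r -[leLHS]expR0 ler_expR.
rewrite -ler_pdivrMl ?ltr0n ?fact_gt0// mulrC.
by rewrite (le_trans _ (expR_ge1Dxn n s0))// lerDr.
Qed.

(** Squaring removes the half-integer powers. With s = r / (4u), the squared left-hand side is (4 pi
    / r)^d s^d e^(-2s), whose only dependence on [u] is through the bounded factor s^d e^(-2s). *)
Lemma gauss_fourier_le d (x : Rd[R]_d) u : 0 < u -> 0 < normRd x ->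
  Num.sqrt (pi / u) ^+ d * expR (- (dotRd x x / (4 * u)))
    <= gauss_const d / normRd x ^+ d.
Proof.
move=> u0 x0; set r := dotRd x x; have r0 : 0 < r by rewrite -sqrtr_gt0.
rewrite -(@ler_pXn2r _ 2)//; last 2 first.
  by rewrite nnegrE mulr_ge0// ?expR_ge0// exprn_ge0.
  by rewrite nnegrE divr_ge0 ?exprn_ge0 ?sqrtr_ge0.
rewrite !exprMn exprVn -!exprM ![(d * 2)%N]mulnC !exprM.
have pi4 : 0 <= 4 * pi :> R by rewrite mulr_ge0// pi_ge0.
have q1 : Num.sqrt (pi / u) ^+ 2 = pi / u by rewrite sqr_sqrtr// divr_ge0 ?pi_ge0// ltW.
have q2 : normRd x ^+ 2 = r by rewrite sqr_sqrtr// ltW.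
have q3 : gauss_const d ^+ 2 = (4 * pi) ^+ d * d`!%:R.
  by rewrite sqr_sqrtr// mulr_ge0// exprn_ge0.
rewrite q1 q2 q3.
have s0 : 0 <= r / (4 * u) by rewrite divr_ge0 ?ltW// mulr_gt0.
have -> : pi / u = (4 * pi) / r * (r / (4 * u)) by field; rewrite !gt_eqF.
move: s0; set s := r / (4 * u) => s0.
rewrite [(_ * s) ^+ d]exprMn expr_div_n -!mulrA.
rewrite ler_wpM2l ?exprn_ge0// [leRHS]mulrC ler_wpM2l ?invr_ge0 ?exprn_ge0 ?(ltW r0)//.
rewrite expRN exprVn -ler_pdivlMr ?invr_gt0 ?exprn_gt0 ?expR_gt0// invrK.
apply: le_trans (expr_le_expR d s0) _; rewrite ler_wpM2l//.
by rewrite expr2 ler_peMr ?expR_ge0// -expR0 ler_expR.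
Qed.

Lemma norm_cvgn_le (u : nat -> R) (l M : R) :
  u n @[n --> \oo] --> l -> (forall n, `|u n| <= M) -> `|l| <= M.
Proof.
move=> ul uM; have c : `|u n| @[n --> \oo] --> `|l| by exact: cvg_norm.
rewrite -(cvg_lim _ c)//; apply: limr_le; first by apply: cvgP c.
exact: nearW.
Qed.

Lemma exp_mix_bounds (M : R) f : exp_mix M f -> forall s, 0 <= s -> `|f s| <= M.
Proof.
elim=> {M f}.
- move=> u u0 s s0; rewrite ger0_norm ?expR_ge0// -expR0 ler_expR oppr_le0.
  exact: mulr_ge0.
- by move=> c M f c0 _ IH s s0; rewrite normrM ger0_norm// ler_wpM2l// IH.
- move=> M N f g _ IHf _ IHg s s0; rewrite (le_trans (ler_normD _ _))// lerD//.
    exact: IHf.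
  exact: IHg.
- by move=> M N f MN _ IH s s0; rewrite (le_trans (IH _ s0)).
- move=> M F f _ IH Ff s s0.
  by apply: norm_cvgn_le (Ff s s0) _ => n; exact: IH.
Qed.

(** Nothing is known of [f] at negative arguments, where limits are not controlled; composing with
    the nonnegative [dotRd y y] avoids them. *)
Lemma exp_mix_measurable (M : R) f d : exp_mix M f ->
  measurable_fun setT (fun y : Rd[R]_d => f (dotRd y y)).
Proof.
elim=> {M f}.
- move=> u u0; apply: measurableT_comp; first exact: measurable_expR.
  apply: measurableT_comp => //; apply: measurable_funM => //.
  exact: measurable_dotRdxx.
- by move=> c M f c0 _ IH; apply: measurable_funM.
- by move=> M N f g _ IHf _ IHg; apply: measurable_funD.
- by [].
- move=> M F f _ IH Ff.
  apply: (@measurable_fun_cvg _ _ _ _ (fun n y => F n (dotRd y y))) => // y _.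
  exact: Ff (dotRdxx_ge0 _).
Qed.

(** On an exponential of rate [u] this is [gauss_fourier_le] at [u + e], whose bound is uniform in
    both. The Gaussian factor dominates every integrand, so the estimate passes through the limit
    constructor by dominated convergence. *)
Lemma exp_mix_fourier_le (M : R) f d (x : Rd[R]_d) e : exp_mix M f -> 0 < e ->
  0 < normRd x ->
  `|\int[leb d]_y (cos (dotRd x y) * (f (dotRd y y) * expR (- (e * dotRd y y))))|
    <= M * (gauss_const d / normRd x ^+ d).
Proof.
move=> Mf e0 x0; pose K := gauss_const d / normRd x ^+ d; rewrite -/K.
pose I (g : R -> R) (y : Rd[R]_d) := cos (dotRd x y) * (g (dotRd y y) * expR (- (e * dotRd y y))).
rewrite -[X in Rintegral _ _ X]/(I f).
have mI N g : exp_mix N g -> measurable_fun setT (I g).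
  move=> Ng; apply: measurable_funM.
    rewrite (_ : (fun y => cos (dotRd x y)) = (fun y => cos (dotRd x y + 0))).
      exact: measurable_cos_dotRd.
    by apply/funext => y; rewrite addr0.
  apply: measurable_funM; first exact: exp_mix_measurable Ng.
  apply: exp_mix_measurable (exp_mix_expR (ltW e0)).
have bI N g y : exp_mix N g -> `|I g y| <= N * prodRd (gauss e) y.
  move=> Ng; rewrite prodRd_gauss /I !normrM [`|expR _|]ger0_norm ?expR_ge0//.
  rewrite (@le_trans _ _ (1 * (N * expR (- (e * dotRd y y)))))//; last by rewrite mul1r.
  rewrite ler_pM ?mulr_ge0 ?expR_ge0 ?norm_cos_le1// ler_wpM2r ?expR_ge0//.
  exact: (exp_mix_bounds Ng (dotRdxx_ge0 y)).
have ig N : (leb d).-integrable setT (EFin \o (fun y => N * prodRd (gauss e) y)).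
  apply: integrable_EFinZl; apply: integrable_prodRd; first exact: gauss_ge0.
  exact: integrable_gauss.
have iI N g : exp_mix N g -> (leb d).-integrable setT (EFin \o I g).
  move=> Ng; apply: integrable_dominated (mI _ _ Ng) (ig N) _.
  by move=> y; exact: bI.
elim: Mf => {M f}.
- move=> u u0; rewrite mul1r.
  have ue : 0 < u + e by rewrite (lt_le_trans e0)// lerDr.
  rewrite (_ : I _ = fun y => cos (dotRd x y + 0) * expR (- ((u + e) * dotRd y y))); last first.
    by apply/funext => y; rewrite /I addr0 mulrDl opprD expRD.
  rewrite gauss_fourier_Rd// cos0 mul1r ger0_norm; last first.
    by rewrite mulr_ge0 ?expR_ge0// exprn_ge0.
  exact: gauss_fourier_le.
- move=> c M f c0 Mf IH.
  rewrite (_ : I _ = fun y => c * I f y); last first.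
    by apply/funext => y; rewrite /I; ring.
  rewrite RintegralZl//; last exact: iI Mf.
  by rewrite normrM ger0_norm// -mulrA ler_wpM2l.
- move=> M N f g Mf IHf Ng IHg.
  rewrite (_ : I _ = fun y => I f y + I g y); last first.
    by apply/funext => y; rewrite /I; ring.
  rewrite RintegralD//; [|exact: iI Mf|exact: iI Ng].
  by rewrite (le_trans (ler_normD _ _))// mulrDl lerD.
- move=> M N f MN Mf IH; by rewrite (le_trans IH)// ler_wpM2r// divr_ge0 ?exprn_ge0 ?sqrtr_ge0.
- move=> M F f MF IH Ff.
  have cI y : I (F n) y @[n --> \oo] --> I f y.
    by apply: cvgMr; apply: cvgMl; apply: Ff; exact: dotRdxx_ge0.
  have [_ c] := dominated_cvg_Rintegral (fun n => mI _ _ (MF n)) cI (ig M) (fun n y => bI _ _ _ (MF n)).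
  exact: norm_cvgn_le c IH.
Qed.

End exp_mix_fourier.

(** * The symbol of the stable semigroup *)

Section stable_symbol.
Context {R : realType}.
Let mu := @lebesgue_measure R.
Local Notation leb d := (@lebesgue_Rd R d).

(** An unnormalised Cauchy density. Products of it over the coordinates serve as integrable
    majorants of the symbol, so that no polar coordinates are needed. *)
Definition cauchy (b a : R) : R := (1 + (b * a) ^+ 2)^-1.

Lemma cauchy_ge0 b a : 0 <= cauchy b a.
Proof. by rewrite invr_ge0 addr_ge0// sqr_ge0. Qed.

Lemma continuous_cauchy b : continuous (cauchy b).
Proof.
move=> a; rewrite /continuous_at /cauchy; apply: cvgV.
  by rewrite gt_eqF// ltr_pwDl// sqr_ge0.
apply: cvgD; first exact: cvg_cst.
under eq_fun do rewrite expr2.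
by rewrite expr2; apply: cvgM; apply: cvgMr; exact: cvg_id.
Qed.

Lemma is_derive_atan_scale (b a : R) : b != 0 ->
  is_derive a 1 (fun a => b^-1 * atan (b * a)) (cauchy b a).
Proof.
move=> b0.
have dq : is_derive a 1 (fun a : R => b * a) b.
  have -> : (fun a : R => b * a) = b \*: id by apply/funext => z.
  by apply: is_derive_eq; rewrite /GRing.scale /=; ring.
have dat : is_derive (b * a) 1 (@atan R) (cauchy b a).
  apply: DeriveDef; first exact: derivable_atan.
  by rewrite -derive1E derive1_atan.
have dc := @is_derive1_comp R (@atan R) (fun a : R => b * a) a _ _ dat dq.
have -> : (fun a : R => b^-1 * atan (b * a)) = b^-1 \*: (@atan R \o (fun a : R => b * a)).
  by apply/funext => z; rewrite !fctE.
by apply: is_derive_eq; rewrite /GRing.scale /=; field.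
Qed.

Lemma integral_cauchy b : 0 < b -> (\int[mu]_a (cauchy b a)%:E = (pi / b)%:E)%E.
Proof.
move=> b0; have bn0 := lt0r_neq0 b0.
rewrite ge0_symfun_integralT; last 3 first.
- exact: cauchy_ge0.
- exact: continuous_cauchy.
- by move=> a; rewrite /cauchy /= mulrN sqrrN.
rewrite -set_itvcy.
rewrite (@ge0_continuous_FTC2y _ _ (fun a => b^-1 * atan (b * a)) _ (b^-1 * (pi / 2))).
- by rewrite mulr0 atan0 mulr0 sube0 -EFinM; congr EFin; field.
- by move=> a _; exact: cauchy_ge0.
- by apply: continuous_subspaceT; exact: continuous_cauchy.
- apply: cvgMr.
  apply: (@cvg_comp _ _ _ (fun a => b * a) (@atan R) _ +oo).
    exact/gt0_cvgMry.
  exact: cvgy_atan.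
- by move=> a _; have [] := is_derive_atan_scale a bn0.
- apply: cvg_at_right_filter.
  have [+ _] := is_derive_atan_scale 0 bn0.
  by move=> /derivable1_diffP/differentiable_continuous.
- by move=> a _; rewrite derive1E; have [_ ->] := is_derive_atan_scale a bn0.
Qed.

Lemma integrable_cauchy b : 0 < b -> mu.-integrable setT (EFin \o cauchy b).
Proof.
move=> b0; apply/integrableP; split.
  by apply/measurable_EFinP; exact: continuous_measurable_fun (@continuous_cauchy b).
under eq_integral do rewrite /= ger0_norm ?cauchy_ge0//.
by rewrite integral_cauchy// ltry.
Qed.

Lemma expRN_powR_le (alpha : R) : 0 < alpha ->
  exists2 C : R, 0 < C & forall w, 0 <= w -> expR (- w `^ alpha) <= C * (1 + w ^+ 2)^-1.
Proof.
(* This makes alpha n at least 2, so that for w > 1 one has w^2 <= (w^alpha)^n <= n! exp(w^alpha).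
   The 2 in the constant covers the summand 1, and all of 1 + w^2 when w <= 1. *)
move=> a0; pose n := (Num.truncn (2 / alpha)).+1.
have na : 2 <= alpha * n%:R.
  by rewrite -ler_pdivrMl// mulrC ltW// truncnS_gt.
exists (2 + n`!%:R) => [|w w0]; first by rewrite addr_gt0// ltr0n fact_gt0.
have h0 : 0 < 1 + w ^+ 2 by rewrite ltr_pwDl// sqr_ge0.
rewrite ler_pdivlMr// mulrC expRN ler_pdivrMr ?expR_gt0// mulrDl.
have e1 : 1 <= expR (w `^ alpha) by rewrite -expR0 ler_expR powR_ge0.
have [w1|w1] := leP w 1.
  apply: (@le_trans _ _ 2).
    by rewrite (_ : 2 = 1 + 1)// lerD// expr_le1.
  rewrite (@le_trans _ _ (2 * expR (w `^ alpha)))//.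
    by rewrite ler_peMr.
  by rewrite lerDl mulr_ge0 ?expR_ge0.
rewrite lerD//; first by rewrite (le_trans e1)// ler_peMl ?expR_ge0// ler1n.
apply: le_trans (expr_le_expR n (powR_ge0 w alpha)).
rewrite -powR_mulrn ?powR_ge0// -powRrM -powR_mulrn//.
by rewrite ler_powR// ltW.
Qed.

Lemma normRd_ge_coord d (y : Rd[R]_d) i : `|tnth y i| <= normRd y.
Proof.
rewrite -sqrtr_sqr ler_sqrt; last exact: dotRdxx_ge0.
rewrite /dotRd (bigD1 i)//= -expr2 lerDl.
by apply: sumr_ge0 => j _; rewrite -expr2 sqr_ge0.
Qed.

Lemma normRd_powR d (y : Rd[R]_d) a : normRd y `^ a = dotRd y y `^ (2^-1 * a).
Proof. by rewrite /normRd -powR12_sqrt ?dotRdxx_ge0// -powRrM. Qed.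

Lemma measurable_stable_symbol d (alpha t : R) :
  measurable_fun setT (fun y : Rd[R]_d => expR (- t * normRd y `^ alpha)).
Proof.
apply: measurableT_comp; first exact: measurable_expR.
apply: measurable_funM => //; under eq_fun do rewrite normRd_powR.
exact: (measurableT_comp (@measurable_powR R (2^-1 * alpha)) (@measurable_dotRdxx R d)).
Qed.

(** Since |y| dominates each coordinate, t |y|^alpha is at least the sum over i of (t / d)
    |y_i|^alpha, and the symbol is bounded by a product of one-dimensional ones. The scale b is
    chosen so that b^alpha = t / d. *)
Lemma stable_symbol_le d (alpha : R) : (1 <= d)%N -> 0 < alpha ->
  exists2 C : R, 0 < C & forall t (y : Rd[R]_d), 0 < t ->
    expR (- t * normRd y `^ alpha) <=
      C * prodRd (cauchy ((t / d%:R) `^ alpha^-1)) y.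
Proof.
move=> d1 a0; have [C C0 HC] := expRN_powR_le a0.
exists (C ^+ d); first exact: exprn_gt0.
move=> t y t0; have d0 : 0 < d%:R :> R by rewrite ltr0n.
set b := (t / d%:R) `^ alpha^-1; have b0 : 0 <= b by exact: powR_ge0.
have bE : b `^ alpha = t / d%:R.
  by rewrite /b -powRrM mulVf ?gt_eqF// powRr1// divr_ge0 ?(ltW t0) ?(ltW d0).
apply: (@le_trans _ _ (\prod_(i < d) expR (- (b * `|tnth y i|) `^ alpha))).
  rewrite -expR_sum ler_expR sumrN mulNr lerN2.
  apply: (@le_trans _ _ (\sum_(i < d) (t / d%:R * normRd y `^ alpha))).
    apply: ler_sum => i _; rewrite powRM// bE ler_wpM2l ?divr_ge0 ?(ltW t0) ?(ltW d0)//.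
    by rewrite ge0_ler_powR ?nnegrE ?sqrtr_ge0 ?normRd_ge_coord// ltW.
  rewrite sumr_const card_ord -[X in X <= _]mulr_natl [X in X <= _]mulrA.
  by rewrite [d%:R * _]mulrCA mulfV ?gt_eqF// mulr1.
have -> : C ^+ d = \prod_(i < d) C by rewrite prodr_const card_ord.
rewrite /prodRd -big_split /=; apply: ler_prod => i _; rewrite expR_ge0 /=.
apply: le_trans (HC _ _) _; first by rewrite mulr_ge0.
by rewrite /cauchy !exprMn real_normK ?num_real.
Qed.

Lemma stable_symbol_integral d (alpha : R) : (1 <= d)%N -> 0 < alpha ->
  exists2 C : R, 0 < C & forall t, 0 < t ->
    (leb d).-integrable setT (EFin \o (fun y : Rd[R]_d => expR (- t * normRd y `^ alpha)))
    /\ \int[leb d]_y expR (- t * normRd y `^ alpha) <= C * t `^ (- (d%:R / alpha)).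
Proof.
move=> d1 a0; have [C C0 HC] := stable_symbol_le d1 a0.
have d0 : 0 < d%:R :> R by rewrite ltr0n.
(* The product majorant integrates to (pi / b)^d with b = (t / d)^(1 / alpha). *)
exists (C * (pi ^+ d * d%:R `^ (d%:R / alpha))).
  by rewrite mulr_gt0// mulr_gt0 ?powR_gt0// exprn_gt0// pi_gt0.
move=> t t0; set b := (t / d%:R) `^ alpha^-1.
have b0 : 0 < b by rewrite powR_gt0// divr_gt0.
have ib := integrable_EFinZl C (integrable_prodRd d (cauchy_ge0 b) (integrable_cauchy b0)).
have H (y : Rd[R]_d) : `|expR (- t * normRd y `^ alpha)| <= C * prodRd (cauchy b) y.
  by rewrite ger0_norm ?expR_ge0//; exact: HC.
have ms := @measurable_stable_symbol d alpha t.
split; first exact: integrable_dominated ms ib H.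
apply: le_trans (ler_norm _) _; apply: le_trans (norm_Rintegral_le ms ib H) _.
rewrite RintegralZl//; last first.
  by apply: integrable_prodRd; [exact: cauchy_ge0|exact: integrable_cauchy].
rewrite -[leRHS]mulrA ler_wpM2l ?(ltW C0)//.
rewrite /Rintegral integral_prodRd ?integrable_cauchy//; last exact: cauchy_ge0.
rewrite /Rintegral integral_cauchy//= expr_div_n -mulrA ler_wpM2l ?exprn_ge0 ?pi_ge0//.
rewrite -powR_mulrn ?(ltW b0)// -powRN /b -powRrM.
have -> : alpha^-1 * - d%:R = - (d%:R / alpha) by rewrite mulrN mulrC.
have dE : d%:R^-1 `^ (- (d%:R / alpha)) = d%:R `^ (d%:R / alpha) :> R.
  by rewrite -powR_inv1 ?(ltW d0)// -powRrM mulN1r opprK.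
by rewrite powRM ?invr_ge0 ?(ltW t0) ?(ltW d0)// dE mulrC.
Qed.

End stable_symbol.

(** * Heat kernel bounds *)

Section heat_kernel_bounds.
Context {R : realType}.
Local Notation leb d := (@lebesgue_Rd R d).

Lemma heat_kernel_cosE d (alpha t : R) (x : Rd[R]_d) :
  heat_kernel alpha t x = ((2 * pi) ^+ d)^-1 *
    \int[leb d]_y (cos (dotRd x y) * expR (- t * normRd y `^ alpha)).
Proof.
rewrite /heat_kernel /inv_fourier /cintegral /semigroup_symbol /cexpi /=.
rewrite mul0r subr0; congr *%R; apply: eq_Rintegral => y _.
by rewrite mulr0 subr0.
Qed.

Lemma heat_kernel_le d (alpha : R) : (1 <= d)%N -> 0 < alpha -> alpha < 2 ->
  exists2 C : R, 0 < C & forall t (x : Rd[R]_d), 0 < t -> 0 < normRd x ->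
    `|heat_kernel alpha t x| <= C * t `^ (- (d%:R / alpha)) /\
    `|heat_kernel alpha t x| <= C * normRd x `^ (- d%:R).
Proof.
move=> d1 a0 a2; have [C C0 HC] := stable_symbol_integral d1 a0.
pose c : R := ((2 * pi) ^+ d)^-1.
have c0 : 0 < c by rewrite invr_gt0 exprn_gt0// mulr_gt0// pi_gt0.
have g0 : 0 <= gauss_const d :> R by exact: sqrtr_ge0.
exists (c * (C + gauss_const d)); first by rewrite mulr_gt0// ltr_wpDr.
move=> t x t0 x0; have [si Hs] := HC t t0.
(* The symbol as a function of |xi|^2, hence with exponent alpha / 2; this is where [alpha < 2]
   places the exponent within the range of [exp_mix_stable]. *)
pose f s := expR (- t * s `^ (2^-1 * alpha)).
have fE (y : Rd[R]_d) : f (dotRd y y) = expR (- t * normRd y `^ alpha).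
  by rewrite normRd_powR.
have Mf : exp_mix 1 f.
  apply: exp_mix_stable; last exact: ltW.
    by rewrite mulr_gt0.
  by rewrite -ler_pdivlMl ?invrK ?mulr1// ltW.
have mc : measurable_fun setT (fun y : Rd[R]_d => cos (dotRd x y)).
  have := @measurable_cos_dotRd R d x 0.
  by apply: eq_measurable_fun => y _; rewrite addr0.
have ms := @measurable_stable_symbol R d alpha t.
rewrite heat_kernel_cosE -/c normrM (ger0_norm (ltW c0)) -!mulrA.
split; rewrite ler_wpM2l ?(ltW c0)//.
  apply: (@le_trans _ _ (\int[leb d]_y expR (- t * normRd y `^ alpha))).
    apply: norm_Rintegral_le => //; first exact: measurable_funM.
    by move=> y; rewrite normrM [`|expR _|]ger0_norm ?expR_ge0// ler_piMl ?expR_ge0// norm_cos_le1.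
  by rewrite (le_trans Hs)// ler_wpM2r ?powR_ge0// lerDl.
(* The Gaussian factor of [exp_mix_fourier_le] is now let go to 1, the symbol itself being the
   dominating function. *)
pose I n (y : Rd[R]_d) :=
  cos (dotRd x y) * (f (dotRd y y) * expR (- (n.+1%:R^-1 * dotRd y y))).
have mI n : measurable_fun setT (I n).
  apply: measurable_funM => //; apply: measurable_funM.
    exact: exp_mix_measurable Mf.
  by apply: exp_mix_measurable (exp_mix_expR _); rewrite invr_ge0.
have cI y : I n y @[n --> \oo] --> cos (dotRd x y) * expR (- t * normRd y `^ alpha).
  apply: cvgMr; rewrite fE -[X in _ --> X]mulr1; apply: cvgMr.
  rewrite -[X in _ --> X]expR0; apply: cvgn_expR_comp; rewrite -[X in _ --> X]oppr0; apply: cvgN.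
  by rewrite -[X in _ --> X](mul0r (dotRd y y)); apply: cvgMl; exact: cvg_harmonic.
have bI n y : `|I n y| <= expR (- t * normRd y `^ alpha).
  rewrite /I fE normrM -[leRHS]mul1r ler_pM ?norm_cos_le1//.
  rewrite ger0_norm ?mulr_ge0 ?expR_ge0// ler_piMr ?expR_ge0// -expR0 ler_expR.
  by rewrite oppr_le0 mulr_ge0 ?invr_ge0 ?dotRdxx_ge0.
have [_ cv] := dominated_cvg_Rintegral mI cI si bI.
apply: norm_cvgn_le cv _ => n.
have n0 : 0 < n.+1%:R^-1 :> R by rewrite invr_gt0.
apply: le_trans (exp_mix_fourier_le Mf n0 x0) _.
rewrite mul1r powRN powR_mulrn ?(ltW x0)// ler_wpM2r ?invr_ge0 ?exprn_ge0 ?(ltW x0)//.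
by rewrite lerDr ltW.
Qed.

End heat_kernel_bounds.

(** * Integrals over time *)

Section integral_comparison.
Context d (T : measurableType d) (R : realType).
Variable m : {measure set T -> \bar R}.
Local Open Scope ereal_scope.

(* [f] is arbitrary because this is applied to the heat kernel, whose
   measurability in time is never established. *)
Lemma integral_le_ge0 (D : set T) (f g : T -> \bar R) :
  (forall x, D x -> f x <= g x) -> (forall x, D x -> 0 <= g x) ->
  \int[m]_(x in D) f x <= \int[m]_(x in D) g x.
Proof.
move=> fg g0; rewrite integralE.
have h : \int[m]_(x in D) f^\+ x <= \int[m]_(x in D) g x.
  (* For a nonnegative function the integral is a supremum over the simple functions below it, so it
     is monotone without measurability. *)
  rewrite !ge0_integralE//; apply: le_ereal_sup => _ [h hf <-]; exists h => // x.
  apply: le_trans (hf x) _; rewrite /patch; case: ifPn => // /set_mem Dx.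
  by rewrite funeposE ge_max fg// g0.
apply: le_trans h; rewrite -[leRHS]sube0; apply: leeB => //.
by apply: integral_ge0.
Qed.

End integral_comparison.

Section time_integrals.
Context {R : realType}.
Let mu := @lebesgue_measure R.

(** Only the majorants [a] and [b] are measurable: they are glued at [tau] into one majorant of [f]
    before the domain is split. *)
Lemma integral_0y_le (f a b : R -> R) (tau A B : R) : 0 < tau ->
  measurable_fun [set: measurableTypeR R] a -> measurable_fun [set: measurableTypeR R] b ->
  (forall t, 0 <= a t) -> (forall t, 0 <= b t) ->
  (forall t, 0 < t -> t <= tau -> f t <= a t) -> (forall t, tau < t -> f t <= b t) ->
  (\int[mu]_(t in `]0%R, tau]) (a t)%:E <= A%:E)%E ->
  (\int[mu]_(t in `[tau, +oo[) (b t)%:E <= B%:E)%E ->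
  (\int[mu]_(t in `]0%R, +oo[) (f t)%:E <= (A + B)%:E)%E.
Proof.
move=> tau0 ma mb a0 b0 fa fb IA IB.
have split0y : `]0, +oo[%classic = `]0, tau]%classic `|` `]tau, +oo[%classic :> set R.
  apply/seteqP; split => t /=; rewrite !in_itv /= !andbT.
    by move=> t0; rewrite t0 /=; case: (leP t tau); [left|right].
  by case=> [/andP[]//|]; exact: lt_trans.
pose g t := if t <= tau then a t else b t.
have mg : measurable_fun [set: measurableTypeR R] g.
  apply: measurable_fun_ifT => //.
  exact: measurable_fun_ler.
have g0 t : 0 <= g t by rewrite /g; case: ifP.
apply: (@le_trans _ _ (\int[mu]_(t in `]0%R, +oo[) (g t)%:E)%E).
  apply: integral_le_ge0 => t /=; last by rewrite lee_fin.
  rewrite in_itv /= andbT lee_fin /g => t0.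
  by case: (leP t tau) => h; [exact: fa|exact: fb].
rewrite split0y ge0_integral_setU//=; last 3 first.
- by apply: measurable_funTS; exact/measurable_EFinP.
- by move=> t _; rewrite lee_fin.
- apply/disj_setPS => t /= []; rewrite !in_itv /= andbT => /andP[_ h1 h2].
  by move: (lt_le_trans h2 h1); rewrite ltxx.
rewrite EFinD; apply: leeD.
  rewrite (eq_integral (fun t : measurableTypeR R => (a t)%:E))// => t; rewrite inE /= in_itv /= => /andP[_ h].
  by rewrite /g h.
apply: le_trans IB; rewrite -integral_itv_obnd_cbnd; last first.
  by apply: measurable_funTS; exact/measurable_EFinP.
rewrite (eq_integral (fun t : measurableTypeR R => (b t)%:E))// => t; rewrite inE /= in_itv /= andbT => h.
by rewrite /g leNgt h.
Qed.

Lemma is_derive_powR (c t : R) : 0 < t ->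
  is_derive t 1 (@powR R ^~ c) (c * t `^ (c - 1)).
Proof.
move=> t0; have tin : t \in `]0%R, +oo[ by rewrite in_itv /= t0.
apply: DeriveDef; first exact: derivable_powR.
by rewrite -derive1E powR_derive1.
Qed.

Lemma cvgy_powRN (s : R) : 0 < s -> t `^ (- s) @[t --> +oo] --> (0 : R).
Proof.
move=> s0; apply/cvgrPdist_le => e e0; near=> t.
have t0 : 0 < t by near: t; exact: nbhs_pinfty_gt.
rewrite sub0r normrN ger0_norm ?powR_ge0// powRN.
rewrite -[leRHS]invrK lef_pV2 ?posrE ?powR_gt0 ?invr_gt0//.
have -> : e^-1 = (e^-1 `^ s^-1) `^ s.
  by rewrite -powRrM mulVf ?gt_eqF// powRr1// invr_ge0 ltW.
rewrite ge0_ler_powR ?nnegrE ?powR_ge0 ?(ltW s0) ?(ltW t0)//.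
Unshelve. all: by end_near. Qed.

Lemma integral_powR_tail (p tau : R) : 1 < p -> 0 < tau ->
  (\int[mu]_(t in `[tau, +oo[) (t `^ (- p))%:E =
   ((p - 1)^-1 * tau `^ (1 - p))%:E)%E.
Proof.
move=> p1 tau0; have p10 : 0 < p - 1 by rewrite subr_gt0.
have dF (t : R) : 0 < t ->
    is_derive t 1 (fun t : R => - (p - 1)^-1 * t `^ (1 - p)) (t `^ (- p)).
  move=> t0; have d := is_derive_powR (1 - p) t0.
  have -> : (fun t => - (p - 1)^-1 * t `^ (1 - p)) = - (p - 1)^-1 \*: (@powR R ^~ (1 - p)).
    by apply/funext => z.
  apply: is_derive_eq; rewrite /GRing.scale /= addrAC subrr sub0r.
  by rewrite mulrA (_ : - _ * _ = 1) ?mul1r//; field; rewrite gt_eqF.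
have cF (t : R) : 0 < t -> {for t, continuous (fun t : R => - (p - 1)^-1 * t `^ (1 - p))}.
  by move=> t0; have [+ _] := dF t t0 => /derivable1_diffP/differentiable_continuous.
rewrite (@ge0_continuous_FTC2y _ _ (fun t => - (p - 1)^-1 * t `^ (1 - p)) _ 0).
- by rewrite mulNr EFinN sub0e oppeK.
- by move=> t _; exact: powR_ge0.
- apply: continuous_in_subspaceT => t; rewrite inE /= in_itv /= andbT => tt.
  exact: cvg_powR_nbhs (lt_le_trans tau0 tt).
- rewrite -[X in _ --> X](mulr0 (- (p - 1)^-1)); apply: cvgMr.
  by rewrite -(opprB p 1); exact: cvgy_powRN.
- by move=> t tt; have [] := dF t (lt_trans tau0 tt).
- by apply: cvg_at_right_filter; exact: cF.
- move=> t; rewrite in_itv /= andbT => tt; rewrite derive1E.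
  by have [_ ->] := dF t (lt_trans tau0 tt).
Qed.

(** Writing the antiderivative as -ln(l + 1/t), and not as a difference of two unbounded logarithms,
    gives its limit -ln l at infinity by continuity. *)
Lemma integral_log_tail (l tau : R) : 0 < l -> 0 < tau ->
  (\int[mu]_(t in `[tau, +oo[) (t * (1 + l * t))^-1%:E =
   (ln (1 + 1 / (l * tau)))%:E)%E.
Proof.
move=> l0 tau0.
have dF (t : R) : 0 < t ->
    is_derive t 1 (fun t : R => - ln (l + t^-1)) (t * (1 + l * t))^-1.
  move=> t0; have tn0 := lt0r_neq0 t0.
  have lt0 : 0 < l + t^-1 by rewrite addr_gt0// invr_gt0.
  have dV : is_derive t 1 (fun t : R => l + t^-1) (- t ^- 2).
    have := is_deriveD (is_derive_cst l t 1) (is_deriveV tn0 (is_derive_id t (1 : R))).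
    move=> d; apply: (is_derive_eq d); by rewrite add0r /GRing.scale /= mulr1.
  have dl := @is_derive1_comp R (@ln R) (fun t : R => l + t^-1) t _ _ (is_derive1_ln lt0) dV.
  have := is_deriveN dl; move=> d; apply: (is_derive_eq d).
  have h1 : 1 + l * t != 0 by rewrite gt_eqF// addr_gt0// mulr_gt0.
  have h2 : l * t + 1 != 0 by rewrite addrC.
  by field; rewrite ?tn0 ?h1 ?h2.
have cF (t : R) : 0 < t -> {for t, continuous (fun t : R => - ln (l + t^-1))}.
  by move=> t0; have [+ _] := dF t t0 => /derivable1_diffP/differentiable_continuous.
rewrite (@ge0_continuous_FTC2y _ _ (fun t : R => - ln (l + t^-1)) _ (- ln l)).
- rewrite -EFinB opprK addrC -ln_div ?posrE ?addr_gt0 ?invr_gt0//.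
  congr ((ln _)%:E); field; by rewrite !gt_eqF.
- move=> t tt; have t0 := le_trans (ltW tau0) tt.
  by rewrite invr_ge0 mulr_ge0// addr_ge0// mulr_ge0// ltW.
- apply: continuous_in_subspaceT => t; rewrite inE /= in_itv /= andbT => tt.
  have t0 := lt_le_trans tau0 tt.
  apply: cvgV; first by rewrite gt_eqF// mulr_gt0 ?addr_gt0 ?mulr_gt0.
  apply: cvgM; first exact: cvg_id.
  by apply: cvgD; [exact: cvg_cst|apply: cvgMr; exact: cvg_id].
- apply: cvgN.
  apply: continuous_cvg; first exact: continuous_ln.
  rewrite -[X in _ --> X]addr0; apply: cvgD; first exact: cvg_cst.
  apply/gtr0_cvgV0; last exact: cvg_id.
  exact: nbhs_pinfty_gt.
- by move=> t tt; have [] := dF t (lt_trans tau0 tt).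
- by apply: cvg_at_right_filter; exact: cF.
- move=> t; rewrite in_itv /= andbT => tt; rewrite derive1E.
  by have [_ ->] := dF t (lt_trans tau0 tt).
Qed.

Lemma integral_powR_0 (q tau : R) : 0 < q -> q < 1 -> 0 < tau ->
  (\int[mu]_(t in `]0%R, tau]) (t `^ (- q))%:E <=
   ((1 - q)^-1 * tau `^ (1 - q))%:E)%E.
Proof.
move=> q0 q1 tau0; have q10 : 0 < 1 - q by rewrite subr_gt0.
(* The singularity at 0 is cut off; the denominator starts at 2 so that the first interval is
   already nondegenerate. *)
pose I (n : nat) := [set` `[(tau / n.+2%:R : R), tau]].
have In0 n : 0 < tau / n.+2%:R by rewrite divr_gt0.
have II : \bigcup_n I n = `]0, tau]%classic.
  apply/seteqP; split => t /=.
    by move=> [n _]; rewrite /I /= !in_itv /= => /andP[h ->]; rewrite (lt_le_trans (In0 n) h).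
  rewrite in_itv /= => /andP[t0 tt]; exists (Num.truncn (tau / t)) => //.
  rewrite /I /= in_itv /= tt andbT ler_pdivrMr// mulrC -ler_pdivrMr//.
  by rewrite (le_trans (ltW (truncnS_gt _)))// ler_nat.
have mf : measurable_fun [set: measurableTypeR R] (fun t : R => (t `^ (- q))%:E).
  by apply/measurable_EFinP; exact: measurable_powR.
have cI : (\int[mu]_(t in I n) (t `^ (- q))%:E @[n --> \oo] -->
    \int[mu]_(t in \bigcup_n I n) (t `^ (- q))%:E)%E.
  apply: ge0_nondecreasing_set_cvg_integral.
  - move=> k n kn; apply/subsetPset => t; rewrite /I /= !in_itv /= => /andP[h ->].
    rewrite andbT (le_trans _ h)// ler_pM2l// lef_pV2 ?posrE//.
    by rewrite ler_nat.
  - by move=> n; exact: measurable_itv.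
  - by move=> n; exact: measurable_funTS.
  - by move=> n t _; rewrite lee_fin powR_ge0.
have dF (t : R) : 0 < t ->
    is_derive t 1 (fun t : R => (1 - q)^-1 * t `^ (1 - q)) (t `^ (- q)).
  move=> t0; have d := is_derive_powR (1 - q) t0.
  have -> : (fun t => (1 - q)^-1 * t `^ (1 - q)) = (1 - q)^-1 \*: (@powR R ^~ (1 - q)).
    by apply/funext => z.
  apply: is_derive_eq; rewrite /GRing.scale /= addrAC subrr sub0r.
  by rewrite mulrA mulVf ?mul1r// gt_eqF.
have cF (t : R) : 0 < t -> {for t, continuous (fun t : R => (1 - q)^-1 * t `^ (1 - q))}.
  by move=> t0; have [+ _] := dF t t0 => /derivable1_diffP/differentiable_continuous.
rewrite -II -(cvg_lim _ cI)//; apply: lime_le; first by apply: cvgP cI.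
apply: nearW => n; rewrite (@continuous_FTC2 _ _ (fun t => (1 - q)^-1 * t `^ (1 - q))).
- by rewrite -EFinB lee_fin gerBl mulr_ge0 ?powR_ge0// invr_ge0 ltW.
- by rewrite gtr_pMr// invf_lt1// ltr1n.
- apply: continuous_in_subspaceT => t; rewrite inE /= in_itv /= => /andP[tt _].
  exact: cvg_powR_nbhs (lt_le_trans (In0 n) tt).
- split.
  + by move=> t; rewrite in_itv /= => /andP[tt _]; have [] := dF t (lt_trans (In0 n) tt).
  + by apply: cvg_at_right_filter; exact: cF.
  + by apply: cvg_at_left_filter; exact: cF.
- move=> t; rewrite in_itv /= => /andP[tt _]; rewrite derive1E.
  by have [_ ->] := dF t (lt_trans (In0 n) tt).
Qed.

End time_integrals.

(** * Resolvent kernel bounds *)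

Section resolvent_kernel_bounds.
Context {R : realType}.
Let mu := @lebesgue_measure R.

Lemma integral_cst_le (c tau : R) : 0 < tau ->
  (\int[mu]_(t in `]0%R, tau]) c%:E <= (c * tau)%:E)%E.
Proof.
move=> tau0; rewrite integral_cst//= lebesgue_measure_itv/= lte_fin tau0.
by rewrite -EFinB subr0 -EFinM.
Qed.

Lemma integralZl_le (D : set (measurableTypeR R)) (c : R) (g : R -> R) (B : R) :
  measurable D -> 0 <= c -> measurable_fun D g -> (forall t, D t -> 0 <= g t) ->
  (\int[mu]_(t in D) (g t)%:E <= B%:E)%E ->
  (\int[mu]_(t in D) (c * g t)%:E <= (c * B)%:E)%E.
Proof.
move=> mD c0 mg g0 IB; under eq_integral do rewrite EFinM.
rewrite ge0_integralZl_EFin//; last exact/measurable_EFinP.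
by rewrite EFinM lee_wpmul2l// lee_fin.
Qed.

Variables (d : nat) (alpha C : R).
Hypotheses (d_ge1 : (1 <= d)%N) (alpha_gt0 : 0 < alpha) (C_gt0 : 0 < C).
Hypothesis heat_le : forall t (x : Rd[R]_d), 0 < t -> 0 < normRd x ->
    `|heat_kernel alpha t x| <= C * t `^ (- (d%:R / alpha)) /\
    `|heat_kernel alpha t x| <= C * normRd x `^ (- d%:R).

Lemma resolvent_integrand_le lambda t (x : Rd[R]_d) (e B : R) :
  0 <= lambda -> 0 < t -> expR (- lambda * t) <= e ->
  `|heat_kernel alpha t x| <= B -> expR (- lambda * t) * heat_kernel alpha t x <= e * B.
Proof.
move=> l0 t0 ee hB; apply: (@le_trans _ _ (expR (- lambda * t) * `|heat_kernel alpha t x|)).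
  by rewrite ler_wpM2l ?expR_ge0// ler_norm.
by rewrite ler_pM ?expR_ge0.
Qed.

Lemma expRN_le1 (lambda t : R) : 0 <= lambda -> 0 < t -> expR (- lambda * t) <= 1.
Proof.
by move=> l0 t0; rewrite -expR0 ler_expR mulNr oppr_le0 mulr_ge0// ltW.
Qed.

Lemma short_time_le lambda t (x : Rd[R]_d) : 0 <= lambda -> 0 < t -> 0 < normRd x ->
  expR (- lambda * t) * heat_kernel alpha t x <= C * normRd x `^ (- d%:R).
Proof.
move=> l0 t0 x0; have [_ h] := heat_le t0 x0.
by rewrite -[leRHS]mul1r; apply: resolvent_integrand_le => //; exact: expRN_le1.
Qed.

(** Here [e] is the part of the exponential decay that is kept: 1, 1 / (1 + lambda t) or 1 / (lambda
    t), according to what the integral in [t] requires. *)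
Lemma long_time_le lambda t (x : Rd[R]_d) (e : R) : 0 <= lambda -> 0 < t -> 0 < normRd x ->
  expR (- lambda * t) <= e ->
  expR (- lambda * t) * heat_kernel alpha t x <= C * (e * t `^ (- (d%:R / alpha))).
Proof.
move=> l0 t0 x0 he; have [h _] := heat_le t0 x0.
by rewrite mulrCA; apply: resolvent_integrand_le.
Qed.

Lemma measurable_powR_cst (p c : R) :
  measurable_fun [set: measurableTypeR R] (fun t : R => c * t `^ p).
Proof. by apply: measurable_funM => //; exact: measurable_powR. Qed.

Lemma short_time_integral_le (x : Rd[R]_d) : 0 < normRd x ->
  (\int[mu]_(t in `]0%R, (normRd x `^ alpha)%R]) (C * normRd x `^ (- d%:R))%:E
     <= (C * normRd x `^ (alpha - d%:R))%:E)%E.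
Proof.
move=> x0; apply: le_trans (integral_cst_le _ (powR_gt0 _ x0)) _.
rewrite lee_fin -mulrA -powRD ?[_ + alpha]addrC//.
by apply/implyP => _; rewrite gt_eqF.
Qed.

(** As d / alpha > 1, the power t^(-d/alpha) is integrable at infinity without help from the
    exponential, whence uniformity down to [lambda = 0]. At the splitting time |x|^alpha both pieces
    scale as |x|^(alpha - d). *)
Lemma resolvent_kernel_le_lt : alpha < d%:R ->
  forall lambda (x : Rd[R]_d), 0 <= lambda -> 0 < normRd x ->
  (resolvent_kernel alpha lambda x <=
    ((C + C * (d%:R / alpha - 1)^-1) * normRd x `^ (alpha - d%:R))%:E)%E.
Proof.
move=> ad lambda x l0 x0; have tau0 := powR_gt0 alpha x0.
have p1 : 1 < d%:R / alpha by rewrite ltr_pdivlMr// mul1r.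
rewrite mulrDl; apply: (@integral_0y_le _ _ (cst (C * normRd x `^ (- d%:R)))
  (fun t => C * t `^ (- (d%:R / alpha))) (normRd x `^ alpha)) => //.
- exact: measurable_powR_cst.
- by move=> t; rewrite mulr_ge0 ?powR_ge0// ltW.
- by move=> t; rewrite mulr_ge0 ?powR_ge0// ltW.
- by move=> t t0 _; exact: short_time_le.
- move=> t tt; have t0 := lt_trans tau0 tt.
  by rewrite -[X in C * X]mul1r; apply: long_time_le => //; exact: expRN_le1.
- exact: short_time_integral_le.
rewrite -mulrA; apply: integralZl_le => //; first exact: ltW.
- by apply: measurable_funTS; exact: measurable_powR.
- by move=> t _; exact: powR_ge0.
rewrite integral_powR_tail// lee_fin -powRrM ler_wpM2l ?invr_ge0 ?subr_ge0 ?(ltW p1)//.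
by rewrite mulrBr mulr1 mulrCA mulfV ?gt_eqF// mulr1.
Qed.

(** The power is now 1/t, which is not integrable at infinity. Keeping the decay 1 / (1 + lambda t)
    makes the tail integral exactly the logarithm. *)
Lemma resolvent_kernel_le_eq : alpha = 1 -> d = 1%N ->
  forall lambda (x : Rd[R]_d), 0 < lambda -> 0 < normRd x ->
  (resolvent_kernel alpha lambda x <=
    (C * (ln (1 + 1 / (lambda * normRd x)) + 1))%:E)%E.
Proof.
move=> a1 dd1 lambda x l0 x0; have tau0 := powR_gt0 alpha x0.
have tauE : normRd x `^ alpha = normRd x by rewrite a1 powRr1// ltW.
(* The power -1 replaces the inverse because [integral_0y_le] wants a majorant that is nonnegative
   on the whole line; the two agree for positive [t]. *)
have mb : measurable_fun [set: measurableTypeR R] (fun t : R => (t * (1 + lambda * t)) `^ (-1)).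
  apply: (measurableT_comp (@measurable_powR R (-1))).
  by apply: measurable_funM => //; apply: measurable_funD => //; exact: measurable_funM.
rewrite addrC mulrDr; apply: (@integral_0y_le _ _ (cst (C * normRd x `^ (- d%:R)))
  (fun t => C * (t * (1 + lambda * t)) `^ (-1)) (normRd x `^ alpha)) => //.
- exact: measurable_funM.
- by move=> t; rewrite mulr_ge0 ?powR_ge0// ltW.
- by move=> t; rewrite mulr_ge0 ?powR_ge0// ltW.
- by move=> t t0 _; apply: short_time_le => //; exact: ltW.
- move=> t tt; have t0 := lt_trans tau0 tt.
  have lt0 : 0 < 1 + lambda * t by rewrite addr_gt0// mulr_gt0.
  have -> : (t * (1 + lambda * t)) `^ (-1) = (1 + lambda * t)^-1 * t `^ (- (d%:R / alpha)).
    by rewrite a1 dd1 divr1 !powR_inv1 ?mulr_ge0 ?(ltW t0) ?(ltW lt0)// invfM mulrC.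
  apply: long_time_le => //; first exact: ltW.
  by rewrite mulNr expRN lef_pV2 ?posrE ?expR_gt0// expR_ge1Dx.
- have := short_time_integral_le x0.
  by rewrite (_ : alpha - d%:R = 0) ?powRr0// a1 dd1 subrr.
apply: integralZl_le => //; first exact: ltW.
- exact: measurable_funTS.
- by move=> t _; exact: powR_ge0.
rewrite tauE -integral_log_tail//.
rewrite (eq_integral (fun t : measurableTypeR R => (t * (1 + lambda * t))^-1%:E))//.
move=> t; rewrite inE /= in_itv /= andbT => tt; have t0 := lt_le_trans x0 tt.
by rewrite powR_inv1// ltW// mulr_gt0// addr_gt0// mulr_gt0.
Qed.

(** Now t^(-1/alpha) is integrable at 0, so the bound uniform in [x] serves at all times. Beyond 1 /
    lambda the decay 1 / (lambda t) makes the tail converge, and both pieces scale as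
    lambda^(1/alpha - 1). The factor [alpha] in the constant is 1 / (p - 1) for the tail exponent p
    = 1 + 1 / alpha. *)
Lemma resolvent_kernel_le_gt : 1 < alpha -> d = 1%N ->
  forall lambda (x : Rd[R]_d), 0 < lambda -> 0 < normRd x ->
  (resolvent_kernel alpha lambda x <=
    ((C * (1 - alpha^-1)^-1 + C * alpha) * lambda `^ ((1 - alpha) / alpha))%:E)%E.
Proof.
move=> a1 dd1 lambda x l0 x0.
have tau0 : 0 < lambda^-1 by rewrite invr_gt0.
have dE : d%:R / alpha = alpha^-1 by rewrite dd1 div1r.
have q0 : 0 < alpha^-1 by rewrite invr_gt0.
have q1 : alpha^-1 < 1 by rewrite invf_lt1.
have eE : (1 - alpha) / alpha = alpha^-1 - 1 by rewrite mulrBl div1r mulfV// gt_eqF.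
have lE p : lambda^-1 `^ p = lambda `^ (- p).
  by rewrite -powR_inv1 ?(ltW l0)// -powRrM mulN1r.
rewrite mulrDl eE; apply: (@integral_0y_le _ _ (fun t => C * t `^ (- alpha^-1))
  (fun t => C * lambda^-1 * t `^ (- (1 + alpha^-1))) lambda^-1) => //.
- exact: measurable_powR_cst.
- exact: measurable_powR_cst.
- by move=> t; rewrite mulr_ge0 ?powR_ge0// ltW.
- by move=> t; rewrite mulr_ge0 ?powR_ge0// ltW// divr_gt0.
- move=> t t0 _; rewrite -dE -[X in C * X]mul1r; apply: long_time_le => //.
    exact: ltW.
  by apply: expRN_le1 => //; exact: ltW.
- move=> t tt; have t0 := lt_trans tau0 tt.
  have := @long_time_le lambda t x ((lambda * t)^-1) (ltW l0) t0 x0.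
  have -> : (lambda * t)^-1 * t `^ (- (d%:R / alpha)) = lambda^-1 * t `^ (- (1 + alpha^-1)).
    rewrite dE opprD powRD; last by apply/implyP => _; rewrite gt_eqF.
    by rewrite powR_inv1 ?(ltW t0)// invfM mulrA.
  rewrite mulrA; apply.
  rewrite mulNr expRN lef_pV2 ?posrE ?expR_gt0 ?mulr_gt0//.
  by rewrite (le_trans _ (expR_ge1Dx _))// lerDr.
- rewrite -mulrA; apply: integralZl_le => //; first exact: ltW.
  + by apply: measurable_funTS; exact: measurable_powR.
  + by move=> t _; exact: powR_ge0.
  apply: le_trans (integral_powR_0 q0 q1 tau0) _.
  by rewrite lE opprB.
apply: (@le_trans _ _ (C * lambda^-1 * (alpha * lambda^-1 `^ (- alpha^-1)))%:E)%E.
  apply: integralZl_le => //; first by rewrite ltW// divr_gt0.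
  + by apply: measurable_funTS; exact: measurable_powR.
  + by move=> t _; exact: powR_ge0.
  rewrite integral_powR_tail//; last by rewrite ltrDl.
  by rewrite [1 + _]addrC addrK invrK opprD addrCA addrN addr0.
rewrite lee_fin lE opprK powRD; last by apply/implyP => _; rewrite gt_eqF.
by rewrite powR_inv1 ?(ltW l0)// -!mulrA ler_wpM2l ?(ltW C_gt0)// mulrCA [_ * lambda^-1]mulrC.
Qed.

End resolvent_kernel_bounds.

Theorem proposition6p1 (R : realType) (alpha : R) (d : nat)
    (alpha_gt0 : 0 < alpha) (alpha_lt2 : alpha < 2) (d_ge1 : (1 <= d)%N) :
  exists C : R, 0 < C /\
    (forall (lambda : R) (x : Rd[R]_d), 0 < lambda -> x != Rd0 d ->
       (resolvent_kernel alpha lambda x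
          <= (C * resolvent_bound alpha lambda x)%:E)%E) /\
    (alpha < d%:R -> forall x : Rd[R]_d, x != Rd0 d ->
       (resolvent_kernel alpha 0 x <= (C * resolvent_bound alpha 0 x)%:E)%E).
Proof.
have [C C0 HC] := heat_kernel_le d_ge1 alpha_gt0 alpha_lt2.
(* Because alpha < 2, the two cases with d <= alpha are one-dimensional. *)
have d1 : d%:R <= alpha -> d = 1%N.
  move=> da; apply/eqP; rewrite eqn_leq d_ge1 andbT -ltnS -(ltr_nat R).
  exact: le_lt_trans da alpha_lt2.
have [ad|da|ad] := ltgtP alpha d%:R.
- exists (C + C * (d%:R / alpha - 1)^-1); split.
    by rewrite addr_gt0// mulr_gt0// invr_gt0 subr_gt0 ltr_pdivlMr// mul1r.
  by split=> [lambda x l0|_ x] /normRd_gt0 x0; rewrite /resolvent_bound ad;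
    apply: resolvent_kernel_le_lt => //; exact: ltW.
- have dE := d1 (ltW da); have a1 : 1 < alpha by move: da; rewrite dE.
  exists (C * (1 - alpha^-1)^-1 + C * alpha); split.
    by rewrite addr_gt0// mulr_gt0// invr_gt0 subr_gt0 invf_lt1.
  split=> // lambda x l0 /normRd_gt0 x0.
  rewrite /resolvent_bound ltNge (ltW da) gt_eqF//=.
  apply: le_trans (resolvent_kernel_le_gt alpha_gt0 C0 HC a1 dE l0 x0) _.
  rewrite lee_fin ler_wpM2l//; last by rewrite lerDr le_min powR_ge0 ler01.
  by rewrite addr_ge0// mulr_ge0 ?(ltW C0)// ?(ltW alpha_gt0)// invr_ge0 subr_ge0 ltW// invf_lt1.
- have dE : d = 1%N by apply: d1; rewrite ad.
  exists C; split => //; split => // lambda x l0 /normRd_gt0 x0.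
  rewrite /resolvent_bound -ad ltxx eqxx.
  by apply: resolvent_kernel_le_eq => //; rewrite ad dE.
Qed.
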